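(* Let $\Omega\subset\mathbb{R}^N$, $N\ge2$, be a convex domain such that $d(x):=\mathrm{dist}(x,\partial\Omega)$ is bounded in $\Omega$. Then there exists a positive constant $D_0\ge\sup_{x\in\Omega}d(x)$ such that for any $D\ge D_0$ and all real-valued $u\in C_c^\infty(\Omega)$ there holds $$\text{(i)}\quad\int_\Omega(\Delta u)^2\,dx\ge\frac14\int_\Omega\frac{|\nabla u|^2}{d^2}\,dx+\frac14\sum_{i=1}^\infty\int_\Omega\frac{|\nabla u|^2}{d^2}X_1^2X_2^2\cdots X_i^2\,dx,$$ $$\text{(ii)}\quad\int_\Omega(\Delta u)^2\,dx\ge\frac{9}{16}\int_\Omega\frac{u^2}{d^4}\,dx+\frac58\sum_{i=1}^\infty\int_\Omega\frac{u^2}{d^4}X_1^2X_2^2\cdots X_i^2\,dx,$$ where $X_j=X_j(d(x)/D)$.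
   Context: The iterated logarithmic functions $X_i$ are defined recursively by $X_1(t)=(1-\log t)^{-1}$ for $t\in(0,1]$ and $X_i(t)=X_1(X_{i-1}(t))$ for $i=2,3,\ldots$, $t\in(0,1]$. All functions are real-valued. *)

(* Defs.v *)
From HB Require Import structures.
From mathcomp Require Import all_boot all_order all_algebra.
From mathcomp Require Import all_classical all_reals all_analysis.

Set Implicit Arguments.
Unset Strict Implicit.
Unset Printing Implicit Defensive.

Import Order.TTheory GRing.Theory Num.Theory.
Import numFieldNormedType.Exports.

Local Open Scope classical_set_scope.
Local Open Scope ring_scope.

(* The sigma-algebra on row vectors is the one generated by the coordinate
   maps, as the library does for tuples; over the reals it is the Borel
   sigma-algebra of R^n. *)
Definition measure_rV_display : measure_display -> measure_display.
Proof. exact. Qed.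

Section measurable_rV.
Context {d} {T : sigmaRingType d}.
Variable n : nat.

Let coors : 'I_n -> 'rV[T]_n -> T := fun i x => x ord0 i.

Let rV_set0 : g_sigma_preimage coors set0.
Proof. exact: sigma_algebra0. Qed.

Let rV_setC A : g_sigma_preimage coors A -> g_sigma_preimage coors (~` A).
Proof. exact: sigma_algebraC. Qed.

Let rV_bigcup (F : _^nat) : (forall i, g_sigma_preimage coors (F i)) ->
  g_sigma_preimage coors (\bigcup_i (F i)).
Proof. exact: sigma_algebra_bigcup. Qed.

HB.instance Definition _ := @isMeasurable.Build (measure_rV_display d)
  'rV[T]_n (g_sigma_preimage coors) rV_set0 rV_setC rV_bigcup.

End measurable_rV.

Lemma measurable_coord d (T : measurableType d) n (i : 'I_n) :
  measurable_fun [set: 'rV[T]_n] (fun x : 'rV[T]_n => x ord0 i).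
Proof.
move=> _ Y mY; rewrite setTI; apply: sub_sigma_algebra => /=.
rewrite -bigcup_seq/=; exists i => /=; first by rewrite mem_index_enum.
by exists Y => //; rewrite setTI.
Qed.

Lemma measurable_fun_rVP d1 d2 (T1 : measurableType d1)
    (T2 : measurableType d2) n (f : T1 -> 'rV[T2]_n) :
  measurable_fun [set: T1] f <->
  forall i, measurable_fun [set: T1] (fun x => f x ord0 i).
Proof.
split=> [mf i|mf].
  exact: (measurableT_comp (measurable_coord i) mf).
suff : g_sigma_preimage (fun i (x : 'rV[T2]_n) => x ord0 i) `<=`
    [set A | measurable (f @^-1` A)].
  by move=> sub _ A mA; rewrite setTI; exact: sub.
apply: smallest_sub.
  split=> [|A|F mF].
  - by rewrite /= preimage_set0.
  - by move=> mA; rewrite /= setTD preimage_setC; exact: measurableC.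
  - by rewrite /= preimage_bigcup; exact: bigcupT_measurable.
move=> A; rewrite -bigcup_seq => -[i _ [B mB <-]] /=.
by rewrite setTI -[X in measurable X]setTI; exact: mf.
Qed.

Section lebesgue_rV.
Context {R : realType}.
Local Open Scope ereal_scope.

Definition cons_rV n (p : measurableTypeR R * 'rV[R]_n) : 'rV[R]_n.+1 :=
  \row_(i < n.+1) if unlift ord0 i is Some j then p.2 ord0 j else p.1.

Definition behead_rV n (x : 'rV[R]_n.+1) : 'rV[R]_n :=
  \row_(i < n) x ord0 (lift ord0 i).

Lemma measurable_cons_rV n : measurable_fun setT (@cons_rV n).
Proof.
apply/measurable_fun_rVP => i.
rewrite (_ : (fun _ => _) = fun p : measurableTypeR R * 'rV[R]_n =>
  if unlift ord0 i is Some j then p.2 ord0 j else p.1); last first.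
  by apply/funext => p; rewrite mxE.
case: unliftP => [j _|_]; last exact: measurable_fst.
exact: (measurableT_comp (measurable_coord j) measurable_snd).
Qed.

Lemma measurable_behead_rV n : measurable_fun setT (@behead_rV n).
Proof.
apply/measurable_fun_rVP => i.
rewrite (_ : (fun _ => _) = fun x : 'rV[R]_n.+1 => x ord0 (lift ord0 i)).
  exact: measurable_coord.
by apply/funext => x; rewrite mxE.
Qed.

Lemma cons_rV0 n (p : measurableTypeR R * 'rV[R]_n) :
  cons_rV p ord0 ord0 = p.1.
Proof. by rewrite mxE unlift_none. Qed.

Lemma cons_rVS n (p : measurableTypeR R * 'rV[R]_n) i :
  cons_rV p ord0 (lift ord0 i) = p.2 ord0 i.
Proof. by rewrite mxE liftK. Qed.

Lemma behead_cons_rV n (p : measurableTypeR R * 'rV[R]_n) :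
  behead_rV (cons_rV p) = p.2.
Proof. by apply/rowP => i; rewrite mxE cons_rVS. Qed.

Section step.
Variables (n : nat) (mu : {sigma_finite_measure set 'rV[R]_n -> \bar R}).

Definition lebesgue_rV_step : set 'rV[R]_n.+1 -> \bar R :=
  pushforward (@lebesgue_measure R \x mu) (@cons_rV n).

Let step0 : lebesgue_rV_step set0 = 0.
Proof. by rewrite /lebesgue_rV_step /pushforward preimage_set0 measure0. Qed.

Let step_ge0 A : 0 <= lebesgue_rV_step A.
Proof. by rewrite /lebesgue_rV_step /pushforward; exact: measure_ge0. Qed.

Let step_sigma_additive : semi_sigma_additive lebesgue_rV_step.
Proof.
exact: (@measure_semi_sigma_additive _ _ _
  (measure_function_pushforward__canonical__measure_function_Measure
    (@lebesgue_measure R \x mu) (@measurable_cons_rV n))).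
Qed.

HB.instance Definition _ := isMeasure.Build _ _ _ lebesgue_rV_step
  step0 step_ge0 step_sigma_additive.

Let step_sigma_finite : sigma_finite setT lebesgue_rV_step.
Proof.
have /sigma_finiteP[F [TF ndF Foo]] := sigma_finiteT (@lebesgue_measure R).
have /sigma_finiteP[G [TG ndG Goo]] := sigma_finiteT mu.
exists (fun k => [set x : 'rV[R]_n.+1 | F k (x ord0 ord0)] `&` (@behead_rV n @^-1` G k)).
  apply/seteqP; split=> // x _.
  have [k _ Fk] : (\bigcup_i F i) (x ord0 ord0) by rewrite -TF.
  have [l _ Gl] : (\bigcup_i G i) (behead_rV x) by rewrite -TG.
  exists (maxn k l) => //; split.
    by have /subsetPset := ndF _ _ (leq_maxl k l); exact.
  by have /subsetPset := ndG _ _ (leq_maxr k l); exact.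
move=> k; have [mF Fk] := Foo k; have [mG Gk] := Goo k.
split.
  apply: measurableI.
    rewrite -[X in measurable X]setTI.
    exact: (@measurable_coord _ R n.+1 ord0 measurableT (F k) mF).
  by rewrite -[X in measurable X]setTI; exact: measurable_behead_rV.
rewrite /lebesgue_rV_step /pushforward.
rewrite (_ : _ @^-1` _ = F k `*` G k); last first.
  apply/seteqP; split=> -[a v] /=;
  by rewrite behead_cons_rV cons_rV0.
by rewrite product_measure1E// lte_mul_pinfty// ge0_fin_numE.
Qed.

HB.instance Definition _ := Measure_isSigmaFinite.Build _ _ _ lebesgue_rV_step
  step_sigma_finite.

End step.

(* Lebesgue measure on R^n (on Borel sets), as an iterated product. *)
Fixpoint lebesgue_rV n : {sigma_finite_measure set 'rV[R]_n -> \bar R} :=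
  match n with
  | 0 => dirac (0%R : 'rV[R]_0)
  | n'.+1 => lebesgue_rV_step (lebesgue_rV n')
  end.

Lemma lebesgue_rV_box n (a b : 'rV[R]_n) :
  (forall i, a ord0 i <= b ord0 i)%R ->
  lebesgue_rV n
    [set x | forall i, (a ord0 i <= x ord0 i <= b ord0 i)%R] =
  (\prod_(i < n) (b ord0 i - a ord0 i))%:E.
Proof.
elim: n a b => [|n IHn] a b ab.
  by rewrite big_ord0 /= diracE mem_set//= => -[].
rewrite big_ord_recl EFinM /= /lebesgue_rV_step /pushforward.
have {IHn} /= IH := IHn (behead_rV a) (behead_rV b).
rewrite (_ : _ @^-1` _ = `[a ord0 ord0, b ord0 ord0]%classic `*`
    [set v : 'rV[R]_n | forall i,
      (behead_rV a ord0 i <= v ord0 i <= behead_rV b ord0 i)%R]); last first.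
  apply/seteqP; split=> -[t v] /=.
    move=> H; split=> [|i]; first by have := H ord0; rewrite cons_rV0 in_itv.
    by have := H (lift ord0 i); rewrite cons_rVS !mxE.
  rewrite in_itv => -[tab H] i; have [j ->|->] := unliftP ord0 i.
    by have := H j; rewrite cons_rVS !mxE.
  by rewrite cons_rV0.
rewrite product_measure1E//=; last first.
  rewrite (_ : mkset _ = \bigcap_(i in [set: 'I_n])
      ((fun v : 'rV[R]_n => v ord0 i) @^-1`
        `[behead_rV a ord0 i, behead_rV b ord0 i]%classic)); last first.
    apply/seteqP; split=> v /= H i.
      by move=> _; rewrite /= in_itv /=.
    by have := H i I; rewrite /= in_itv.
  apply: fin_bigcap_measurable => // i _.
  rewrite -[X in measurable X]setTI.
  by apply: (@measurable_coord _ R n i measurableT) => //; exact: measurable_itv.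
rewrite IH => [|i]; last by rewrite !mxE.
congr (_ * _); last first.
  by congr EFin; apply: eq_bigr => i _; rewrite !mxE.
rewrite lebesgue_measure_itv/= lte_fin.
have := ab ord0; rewrite le_eqVlt => /orP[/eqP->|->//].
by rewrite ltxx subrr.
Qed.

End lebesgue_rV.

Section euclidean.
Context {R : realType} {N : nat}.
Implicit Types (A Omega : set 'rV[R]_N) (u : 'rV[R]_N -> R).

Definition domain A := [/\ A !=set0, open A & connected A].

Definition boundary A := closure A `\` interior A.

(* The library norm on 'rV[R]_N is the sup norm, whence this one. *)
Definition enorm (x : 'rV[R]_N) : R := Num.sqrt (\sum_(i < N) x ord0 i ^+ 2).

(* Equal to +oo when A has no boundary, i.e. when A is the whole space. *)
Definition edist_boundary A (x : 'rV[R]_N) : \bar R :=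
  ereal_inf [set (enorm (x - y))%:E | y in boundary A].

Definition dist_boundary A (x : 'rV[R]_N) : R := fine (edist_boundary A x).

Definition partial (i : 'I_N) u : 'rV[R]_N -> R :=
  fun x => 'D_(delta_mx ord0 i) u x.

Definition partials (s : seq 'I_N) u : 'rV[R]_N -> R := foldr partial u s.

Definition smooth u := forall s : seq 'I_N,
  continuous (partials s u) /\
  forall i x, derivable (partials s u) x (delta_mx ord0 i).

(* Elements of C_c^oo(Omega) are identified with their extension by zero to
   the whole space. *)
Definition test_function Omega u :=
  let supp := closure [set x | u x != 0] in
  [/\ smooth u, compact supp & supp `<=` Omega].

Definition grad u (x : 'rV[R]_N) : 'rV[R]_N := \row_(i < N) partial i u x.

Definition laplacian u (x : 'rV[R]_N) : R :=
  \sum_(i < N) partial i (partial i u) x.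

End euclidean.

Section iterated_log.
Context {R : realType}.

Definition X1 (t : R) : R := (1 - ln t)^-1.

(* Meaningful for 1 <= i and 0 < t <= 1; iterlog 1 is convertible to X1. *)
Definition iterlog (i : nat) (t : R) : R := iter i X1 t.

End iterated_log.

(* Main.v *)
Require Import Defs.
From mathcomp Require Import all_boot all_order all_algebra.
From mathcomp Require Import all_classical all_reals all_analysis.
From mathcomp Require Import measurable_realfun ring lra.

Set Implicit Arguments.
Unset Strict Implicit.
Unset Printing Implicit Defensive.

Import Order.TTheory GRing.Theory Num.Theory.
Import numFieldNormedType.Exports.

Local Open Scope classical_set_scope.
Local Open Scope ring_scope.

(** Both inequalities are instances of one weighted Hardy inequality,
[weighted_hardy].  Let d be the distance to the boundary.  In a convex domain
d is concave and its gradient has length 1, so d is superharmonic.  For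
g >= 0 and w > 0, testing - div (grad d) >= 0 against v^2 g(d) and completing
a square gives
  int w(d) |grad v|^2 >= int (- g'(d) - g(d)^2 / w(d)) v^2,
so that everything is reduced to finding good pairs (g, w) of functions of
one variable.  Put t = s / D, B = X_1 + X_1 X_2 + ... + X_1 ... X_n and
S = X_1^2 + X_1^2 X_2^2 + ... + X_1^2 ... X_n^2; then t B' = (B^2 + S) / 2.

For (i), two integrations by parts turn int (laplacian u)^2 into the sum over
k of int |grad (partial k u)|^2 ([int_laplacian_sqr]); the weighted inequality
is applied to each v = partial k u with w = 1 and g = (1 - B) / (2 s), for
which - g' - g^2 is exactly (1 + S) / (4 s^2) ([hardy_riccati]).

For (ii), the weighted inequality is applied a second time, to v = u and the
weight w = (1 + S) / (4 s^2) that (i) has just produced, with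
g = s^-3 (1 + S) (3/8 - B/8 - S); then - g' - g^2 / w is at least
s^-4 (9/16 + 5/8 S) ([rellich_riccati]).  A perturbation - kappa B of 3/8
contributes kappa / 2 to the coefficient of S and is admissible as long as
kappa / 2 >= 4 kappa^2, so kappa = 1/8 is optimal and yields
9/16 + 1/16 = 5/8; the term - S pays for the third order remainders.

These choices need B and S to be small, uniformly in n.  The function
4 / (1 - t) bounds B for every n ([logsum_bound]), which improves to
B <= 9/8 X_1 as soon as t <= [small_t] ([small_tP]); hence the constant
D_0 = M / [small_t], where M bounds d.  The series are then bounded through
their partial sums ([series_bound]).

The function d is never differentiated.  Let x be a point of the domain, y a
nearest boundary point, and nu the unit vector from y to x.  The half-space
through y with inner normal nu contains the domain
([supporting_hyperplane]), so nu is a supergradient of d at x: its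
coordinates lie between the forward and the backward difference quotients of
d.  The gap between the two quotients is a second difference, and against v^2
its integral tends to 0 because translation moves the differences onto v^2,
which is C^1 ([int_second_difference]).  Translation invariance of Lebesgue
measure and dominated convergence are therefore the only facts on integrals
that are needed. *)

(** * Lebesgue measure on R^n: Borel sets and translations *)

Section measure.
Context {R : realType}.

(** Boxes with rational vertices form a countable basis of the topology, and
each of them belongs to the sigma-algebra generated by the coordinates. *)
Lemma open_measurable_rV n (U : set 'rV[R]_n) : open U -> measurable U.
Proof.
move=> oU.
pose Q (p : {ffun 'I_n -> rat * rat}) : set 'rV[R]_n :=
  [set x | forall i, ratr (p i).1 < x ord0 i < ratr (p i).2].
have mQ p : measurable (Q p).
  rewrite (_ : Q p = \bigcap_(i in [set: 'I_n])
      ((fun v : 'rV[R]_n => v ord0 i) @^-1`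
        `](ratr (p i).1), (ratr (p i).2)[%classic)); last first.
    apply/seteqP; split=> v /= H i.
      by move=> _; rewrite /= in_itv /=; exact: H.
    by have := H i I; rewrite /= in_itv.
  apply: fin_bigcap_measurable => // i _.
  rewrite -[X in measurable X]setTI.
  by apply: (@measurable_coord _ R n i measurableT) => //; exact: measurable_itv.
rewrite (_ : U = \bigcup_(p in [set p | Q p `<=` U]) Q p).
  rewrite bigcup_mkcond; apply: countable_bigcupT_measurable => [|p].
    exact: countableP.
  by case: ifP.
apply/seteqP; split=> [x Ux|x [p /= pU]]; last exact: pU.
have /nbhs_ballP[e /= e0 eU] := oU _ Ux.
have H i : exists q : rat * rat, x ord0 i - e < ratr q.1 < x ord0 i /\
   x ord0 i < ratr q.2 < x ord0 i + e.
  have [q1 h1] := @rat_in_itvoo R (x ord0 i - e) (x ord0 i) ltac:(by rewrite ltrBlDr ltrDl).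
  have [q2 h2] := @rat_in_itvoo R (x ord0 i) (x ord0 i + e) ltac:(by rewrite ltrDl).
  by exists (q1, q2); rewrite !in_itv/= in h1 h2.
have [f Hf] := choice H.
exists [ffun i => f i] => /=.
  move=> y /= Qy; apply: eU; split=> // i j; rewrite ord1 /ball/= ltr_norml.
  have := Qy j; rewrite ffunE; have [/andP[a b] /andP[c d]] := Hf j.
  move=> /andP[a' b']; apply/andP; split; lra.
by move=> i; rewrite ffunE; have [/andP[_ ->] /andP[->]] := Hf i.
Qed.

Lemma continuous_measurable_rV n (f : 'rV[R]_n -> R) :
  continuous f -> measurable_fun setT f.
Proof.
move=> cf; apply: (measurability _ (RGenOInfty.measurableE R)).
move=> /= _ [_ [a ->] <-]; rewrite setTI set_itvE; apply: open_measurable_rV.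
by apply: open_comp => [x _|]; [exact: cf|exact: open_gt].
Qed.


(** A translation maps a half-open interval to one of the same length, and
half-open intervals determine the measure. *)
Lemma lebesgue_measure_shift (a : R) (A : set (measurableTypeR R)) :
  measurable A ->
  lebesgue_measure ((fun x => x + a) @^-1` A) = lebesgue_measure A.
Proof.
move=> mA.
have mf : measurable_fun setT ((fun x => x + a) : measurableTypeR R -> measurableTypeR R).
  exact: measurable_funD.
pose nu : {measure set (measurableTypeR R) -> \bar R} :=
  measure_function_pushforward__canonical__measure_function_Measure
    (@lebesgue_measure R) mf.
rewrite -[LHS]/(nu A); apply/esym/lebesgue_measure_unique => // X.
move=> /ocitvP[->|[x x12 ->]]; first by rewrite !measure0.
rewrite -[RHS]/(lebesgue_measure ((fun z => z + a) @^-1` `]x.1, x.2]%classic)).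
rewrite (_ : _ @^-1` _ = `](x.1 - a), (x.2 - a)]%classic); last first.
  by apply/seteqP; split=> z /=; rewrite !in_itv/= ltrBlDr lerBrDr.
rewrite [LHS]lebesgue_measure_itv [RHS]lebesgue_measure_itv/= !lte_fin x12 ltrD2r x12.
by rewrite -!EFinD; congr EFin; lra.
Qed.

Lemma measurable_shift_rV n (a : 'rV[R]_n) :
  measurable_fun setT (fun x : 'rV[R]_n => x + a).
Proof.
apply/measurable_fun_rVP => i.
under eq_fun do rewrite mxE.
by apply: measurable_funD => //; exact: measurable_coord.
Qed.

(** By induction on the dimension: a translation acts separately on the first
coordinate and on the others, so it preserves the measure of rectangles. *)
Lemma lebesgue_rV_shift n (a : 'rV[R]_n) (A : set 'rV[R]_n) :
  measurable A -> lebesgue_rV n ((fun x => x + a) @^-1` A) = lebesgue_rV n A.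
Proof.
elim: n a A => [|n IHn] a A mA.
  by congr (lebesgue_rV 0 _); apply/seteqP; split=> x; rewrite /= (_ : x + a = x)//;
    apply/rowP => -[].
pose a0 := a ord0 ord0; pose a1 := behead_rV a.
have mf : measurable_fun setT
    (fun p : measurableTypeR R * 'rV[R]_n =>
       ((p.1 + a0, p.2 + a1) : measurableTypeR R * 'rV[R]_n)).
  apply: measurable_fun_pair.
    by apply: measurable_funD => //; exact: measurable_fst.
  exact: (measurableT_comp (measurable_shift_rV a1) measurable_snd).
pose nu : {measure set (measurableTypeR R * 'rV[R]_n) -> \bar R} :=
  measure_function_pushforward__canonical__measure_function_Measure
    (@lebesgue_measure R \x lebesgue_rV n)%E mf.
have E : @cons_rV R n @^-1` ((fun x => x + a) @^-1` A) =
    (fun p : measurableTypeR R * 'rV[R]_n =>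
       ((p.1 + a0, p.2 + a1) : measurableTypeR R * 'rV[R]_n)) @^-1`
    (@cons_rV R n @^-1` A).
  apply/funext => p; rewrite /preimage /=; congr (A _).
  by apply/rowP => i; rewrite !mxE; case: unliftP => [j ->|->] //; rewrite !mxE.
have mB : measurable (@cons_rV R n @^-1` A).
  by rewrite -[X in measurable X]setTI; exact: measurable_cons_rV.
rewrite -[RHS]/((@lebesgue_measure R \x lebesgue_rV n)%E (@cons_rV R n @^-1` A)).
rewrite (@product_measure_unique _ _ _ _ _ _ _ nu)//.
- rewrite -[LHS]/((@lebesgue_measure R \x lebesgue_rV n)%E
    (@cons_rV R n @^-1` ((fun x => x + a) @^-1` A))).
  by rewrite E.
- move=> B C {}mB mC.
  rewrite -[LHS]/((@lebesgue_measure R \x lebesgue_rV n)%E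
    (((fun x => x + a0) @^-1` B) `*` ((fun x => x + a1) @^-1` C))).
  rewrite product_measure1E.
  + by congr (_ * _)%E; [exact: lebesgue_measure_shift|exact: IHn].
  + rewrite -[X in measurable X]setTI.
    by apply: (_ : measurable_fun setT (fun x : measurableTypeR R => x + a0)) => //;
      exact: measurable_funD.
  + by rewrite -[X in measurable X]setTI; exact: measurable_shift_rV.
Qed.

End measure.

(** * Integrals of continuous functions with bounded support *)

Section Cc_functions.
Context {R : realType} {N : nat}.
Implicit Types f g : 'rV[R]_N -> R.
Local Notation mu := (lebesgue_rV N).

(** The class on which all integrals below are taken.  The support is bounded
for the sup norm, so that [cube] gives an explicit set of finite measure. *)
Definition Cc f := continuous f /\ exists B, forall x, f x != 0 -> `|x| <= B.

Definition cube (B : R) : set 'rV[R]_N := [set x | `|x| <= B].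

Lemma coord_le_norm (x : 'rV[R]_N) i : `|x ord0 i| <= `|x|.
Proof.
rewrite [leRHS]/Num.norm /= mx_normrE; apply/bigmax_geP; right => /=.
by exists (ord0, i).
Qed.

Lemma norm_le_coord (x : 'rV[R]_N) B : 0 <= B ->
  (forall i, `|x ord0 i| <= B) -> `|x| <= B.
Proof.
move=> B0 xB; rewrite [leLHS]/Num.norm /= mx_normrE; apply/bigmax_leP; split=> //.
by case=> i j _ /=; rewrite ord1.
Qed.

Lemma compact_cube B : compact (cube B).
Proof.
apply: bounded_closed_compact.
  exists B; split; first exact: num_real.
  by move=> M BM x /= xB; rewrite (le_trans xB)// ltW.
rewrite /cube; apply: (@preimage_closed _ _ (fun x : 'rV[R]_N => `|x|) [set y | y <= B]).
  by move=> x _; exact: norm_continuous.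
exact: closed_le.
Qed.

Lemma measurable_cube B : measurable (cube B).
Proof.
rewrite -[cube B]setCK; apply: measurableC; apply: open_measurable_rV.
by apply: closed_openC; apply: compact_closed; [exact: norm_hausdorff|exact: compact_cube].
Qed.

Lemma cube_fin B : (mu (cube B) < +oo)%E.
Proof.
have [B0|B0] := leP 0 B; last first.
  rewrite (_ : cube B = set0) ?measure0// -subset0 => x /= xB.
  by have := le_lt_trans xB B0; rewrite ltNge normr_ge0.
rewrite (_ : cube B = [set x | forall i,
    ((const_mx (-B) : 'rV[R]_N) ord0 i <= x ord0 i <= (const_mx B : 'rV[R]_N) ord0 i)%R]).
  rewrite lebesgue_rV_box ?ltry// => i.
  by rewrite !mxE; lra.
apply/seteqP; split=> x /= H.
  by move=> i; rewrite !mxE -ler_norml (le_trans _ H)// coord_le_norm.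
by apply: norm_le_coord => // i; rewrite ler_norml; have := H i; rewrite !mxE.
Qed.

Lemma bounded_cube_integrable f B C : continuous f ->
  (forall x, `|f x| <= C) -> (forall x, f x != 0 -> `|x| <= B) ->
  mu.-integrable setT (EFin \o f).
Proof.
move=> cf fC fB; have mf := continuous_measurable_rV cf.
have := @measurable_bounded_integrable _ _ _ mu f _ (measurable_cube B) (cube_fin B)
  (measurable_funTS mf).
have : [bounded f x | x in cube B].
  exists C; split; first exact: num_real.
  by move=> M CM x _; apply: (le_trans (fC x)); exact: ltW.
move=> /[swap] /[apply]; rewrite (integrable_mkcond _ (measurable_cube B)).
rewrite (_ : _ \_ _ = EFin \o f)//; apply/funext => x; rewrite patchE.
case: ifPn => //; rewrite notin_setE /= => /negP; rewrite -ltNge => xB.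
have [-> //|/fB] := eqVneq (f x) 0.
by rewrite leNgt xB.
Qed.

Lemma Cc_bounded f : Cc f -> exists2 C, 0 <= C & forall x, `|f x| <= C.
Proof.
move=> [cf [B fB]].
have [[x0 x0B]|/forallNP H] := pselect (cube B !=set0); last first.
  exists 0 => // x; have [->|/fB xB] := eqVneq (f x) 0; first by rewrite normr0.
  by have := H x.
have cnf : {within cube B, continuous (fun x => `|f x|)}.
  by apply: continuous_subspaceT => x; apply: continuous_comp;
    [exact: cf|exact: norm_continuous].
have [c _ Hc] := EVT_max_rV (ex_intro _ x0 x0B) (@compact_cube B) cnf.
exists `|f c| => // x.
have [->|/fB xB] := eqVneq (f x) 0; first by rewrite normr0.
by apply: Hc; rewrite inE.
Qed.

Lemma Cc_integrable f : Cc f -> mu.-integrable setT (EFin \o f).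
Proof.
move=> cf; have [C _ fC] := Cc_bounded cf; have [f0 [B fB]] := cf.
exact: (bounded_cube_integrable f0 fC fB).
Qed.

Lemma Cc_mulr f g : Cc f -> continuous g -> Cc (fun x => f x * g x).
Proof.
move=> [cf [B fB]] cg; split; first by move=> x; apply: continuousM; [exact: cf|exact: cg].
by exists B => x fg; apply: fB; apply: contraNN fg => /eqP ->; rewrite mul0r.
Qed.

Lemma Cc_mull f g : continuous f -> Cc g -> Cc (fun x => f x * g x).
Proof. by move=> cf cg; under eq_fun do rewrite mulrC; exact: Cc_mulr. Qed.

Lemma CcZ a f : Cc f -> Cc (fun x => a * f x).
Proof. by apply: (@Cc_mull (fun=> a) f);
  exact: cst_continuous. Qed.

Lemma CcD f g : Cc f -> Cc g -> Cc (fun x => f x + g x).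
Proof.
move=> [cf [B fB]] [cg [B' gB]].
split; first by move=> x; apply: continuousD; [exact: cf|exact: cg].
exists (Num.max B B') => x; rewrite le_max.
have [->|/fB ->//] := eqVneq (f x) 0.
by rewrite add0r => /gB ->; rewrite orbT.
Qed.

Lemma CcN f : Cc f -> Cc (fun x => - f x).
Proof. move=> /(CcZ (-1)); rewrite (_ : (fun x => -1 * f x) = fun x => - f x)//.
by apply/funext => x; rewrite mulN1r. Qed.

Lemma CcB f g : Cc f -> Cc g -> Cc (fun x => f x - g x).
Proof. by move=> cf cg; apply: CcD => //; exact: CcN. Qed.

Lemma Cc0 : Cc (fun=> 0).
Proof. by split; [exact: cst_continuous|exists 0 => x; rewrite eqxx]. Qed.

Lemma Cc_sum (J : Type) (r : seq J) (P : pred J) (F : J -> 'rV[R]_N -> R) :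
  (forall j, P j -> Cc (F j)) -> Cc (fun x => \sum_(j <- r | P j) F j x).
Proof.
move=> cF; elim: r => [|j r IH].
  by under eq_fun do rewrite big_nil; exact: Cc0.
under eq_fun do rewrite big_cons.
by have [/cF Fj|//] := boolP (P j); apply: CcD.
Qed.

Lemma continuous_translate (a : 'rV[R]_N) f : continuous f -> continuous (fun x : 'rV[R]_N => f (x + a)).
Proof.
move=> cf x; have c : {for x, continuous (fun y : 'rV[R]_N => y + a)}.
  by apply: continuousD; [exact: cvg_id|exact: cst_continuous].
exact: (continuous_comp c (cf _)).
Qed.

Lemma Cc_shift (a : 'rV[R]_N) f : Cc f -> Cc (fun x : 'rV[R]_N => f (x + a)).
Proof.
move=> [cf [B fB]]; split; first exact: continuous_translate.
exists (B + `|a|) => x /fB xa.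
by rewrite -[x](addrK a) (le_trans (ler_normB _ _))// lerD2r.
Qed.

Lemma Cc_intD f g : Cc f -> Cc g ->
  (\int[mu]_x (f x + g x) = \int[mu]_x f x + \int[mu]_x g x)%R.
Proof. by move=> /Cc_integrable cf /Cc_integrable cg; exact: RintegralD. Qed.

Lemma Cc_intB f g : Cc f -> Cc g ->
  (\int[mu]_x (f x - g x) = \int[mu]_x f x - \int[mu]_x g x)%R.
Proof. by move=> /Cc_integrable cf /Cc_integrable cg; exact: RintegralB. Qed.

Lemma Cc_intZ a f : Cc f -> (\int[mu]_x (a * f x) = a * \int[mu]_x f x)%R.
Proof. by move=> /Cc_integrable cf; exact: RintegralZl. Qed.

Lemma Cc_int_sum (J : Type) (r : seq J) (P : pred J) (F : J -> 'rV[R]_N -> R) :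
  (forall j, P j -> Cc (F j)) ->
  (\int[mu]_x (\sum_(j <- r | P j) F j x) = \sum_(j <- r | P j) \int[mu]_x F j x)%R.
Proof.
move=> cF; elim: r => [|j r IH].
  rewrite big_nil; under eq_Rintegral do rewrite big_nil.
  by rewrite /Rintegral integral0.
rewrite big_cons; under eq_Rintegral do rewrite big_cons.
have [/cF Fj|_] := boolP (P j); last exact: IH.
by rewrite Cc_intD ?IH//; exact: Cc_sum.
Qed.

Lemma Cc_int_le f g : Cc f -> Cc g -> (forall x, f x <= g x) ->
  (\int[mu]_x f x <= \int[mu]_x g x)%R.
Proof. by move=> /Cc_integrable cf /Cc_integrable cg fg; exact: le_Rintegral. Qed.

Lemma Cc_int_shift (a : 'rV[R]_N) f : Cc f ->
  (\int[mu]_x f (x + a)%R = \int[mu]_x f x)%R.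
Proof.
move=> cf; rewrite /Rintegral; congr fine.
have mf := continuous_measurable_rV cf.1.
have ms := @measurable_shift_rV R N a.
pose nu : {measure set 'rV[R]_N -> \bar R} :=
  measure_function_pushforward__canonical__measure_function_Measure mu ms.
have -> : (\int[mu]_x (f (x + a)%R)%:E)%E = (\int[nu]_x (f x)%:E)%E.
  rewrite (integral_pushforward ms)//.
  - exact/measurable_EFinP.
  - exact: (Cc_integrable (Cc_shift a cf)).
by apply: eq_measure_integral => A mA _; exact: lebesgue_rV_shift.
Qed.

(** Dominated convergence: a common cube and a common bound make a multiple of
the indicator of the cube a dominating function. *)
Lemma Cc_int_cvg0 (f : nat -> 'rV[R]_N -> R) B C :
  (forall n, continuous (f n)) -> (forall n x, `|f n x| <= C) ->
  (forall n x, f n x != 0 -> `|x| <= B) ->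
  (forall x, f ^~ x @ \oo --> 0) ->
  ((\int[mu]_x f n x)%R @[n --> \oo] --> 0).
Proof.
move=> cf fC fB f0.
pose g x := (C%:E * (\1_(cube B) x)%:E)%E.
have mg : mu.-integrable setT g.
  apply: integrableZl => //; apply/integrableP; split.
    by apply/measurable_EFinP; apply: measurable_indic; exact: measurable_cube.
  rewrite (eq_integral (fun x => (\1_(cube B) x)%:E)).
    by rewrite integral_indic ?setIT ?cube_fin//; exact: measurable_cube.
  by move=> x _; rewrite gee0_abs// lee_fin indicE.
have [|||||_ _ H] := @dominated_convergence _ _ _ mu setT measurableT
  (fun n x => (f n x)%:E) (fun=> 0%:E) g.
- by move=> n; apply/measurable_EFinP; exact: continuous_measurable_rV.
- exact: measurable_cst.
- by apply: aeW => x _; apply: cvg_EFin; [exact: nearW|exact: f0].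
- exact: mg.
- apply: aeW => x n _; rewrite /g -EFinM lee_fin indicE.
  have C0 : 0 <= C by exact: le_trans (fC 0%N 0).
  have [->|fx] := eqVneq (f n x) 0; first by rewrite normr0 mulr_ge0.
  by rewrite mem_set ?mulr1//; exact: (fB n).
move: H; rewrite integral0 => H.
by apply: fine_cvg; exact: H.
Qed.

End Cc_functions.

(** * Derivatives along the coordinates *)

Section coordinate_derivatives.
Context {R : realType} {N : nat}.
Implicit Types (u f g : 'rV[R]_N -> R) (x : 'rV[R]_N) (i j : 'I_N).
Local Notation mu := (lebesgue_rV N).
Local Notation e i := (delta_mx ord0 i : 'rV[R]_N).

Lemma is_derive_line u x (v : 'rV[R]_N) (t : R) :
  derivable u (x + t *: v) v ->
  is_derive t 1 (fun s : R => u (x + s *: v)) ('D_v u (x + t *: v)).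
Proof.
move=> du.
have E : (fun h : R => h^-1 *: (((fun s => u (x + s *: v)) \o shift t) (h *: 1)
     - u (x + t *: v))) =
   (fun h : R => h^-1 *: ((u \o shift (x + t *: v)) (h *: v) - u (x + t *: v))).
  apply/funext => h /=; congr (_ *: (u _ - _)).
  by rewrite scalerDl addrCA [h *: 1]mulr1.
by apply: DeriveDef; rewrite /derivable/derive E.
Qed.

Lemma MVT_line u x (v : 'rV[R]_N) (h : R) :
  (forall y, derivable u y v) ->
  exists2 s, `|s| <= `|h| & u (x + h *: v) - u x = h * 'D_v u (x + s *: v).
Proof.
move=> du; pose g (s : R) := u (x + s *: v).
have dg (s : R) : is_derive s 1 g ('D_v u (x + s *: v)) by exact: is_derive_line.
have cg A : {within A, continuous g}.
  apply: continuous_subspaceT => s; apply: differentiable_continuous.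
  by apply/derivable1_diffP; have [] := dg s.
have [h0|h0] := leP 0 h.
  have [s sh E] := MVT_segment h0 (fun s _ => dg s) (cg _).
  exists s; first by move: sh; rewrite in_itv/= => /andP[s0 sh]; rewrite !ger0_norm.
  by move: E; rewrite /g scale0r addr0 subr0 mulrC.
have [s sh E] := MVT_segment (ltW h0) (fun s _ => dg s) (cg _).
exists s.
  by move: sh; rewrite in_itv/= => /andP[s0 sh]; rewrite !ler0_norm ?lerN2// ltW.
by move: E; rewrite /g scale0r addr0 sub0r => E; rewrite -opprB E mulrN opprK mulrC.
Qed.

Lemma diff_quotient_cvg u x (v : 'rV[R]_N) (h : nat -> R) :
  derivable u x v -> (forall n, h n != 0) -> h @ \oo --> 0 ->
  (h n)^-1 * (u (x + h n *: v) - u x) @[n --> \oo] --> 'D_v u x.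
Proof.
move=> du h0 hc.
have hd : h @ \oo --> 0^'.
  move=> A; rewrite /dnbhs /within/= => /hc [M _ HM].
  by exists M => // n /= Mn; apply: HM.
have := cvg_comp _ _ hd du; apply: cvg_trans; apply: near_eq_cvg.
by apply: nearW => n /=; rewrite [h n *: v + x]addrC.
Qed.

Lemma derive_eq0_out_closure u x (v : 'rV[R]_N) :
  ~ closure [set y | u y != 0] x -> 'D_v u x = 0.
Proof.
move=> nx; rewrite -(derive_cst (0 : R) x v); apply: near_eq_derive.
apply: contra_notP nx => nx B nB.
apply: contrapT => BA; apply: nx; near=> y.
have By : B y by near: y.
by apply: contrapT => uy; apply: BA; exists y; split => //; apply/eqP.
Unshelve. all: by end_near. Qed.

Definition Cc1 u := Cc u /\ forall i, (forall x, derivable u x (e i)) /\ Cc (partial i u).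

Lemma norm_delta_mx i : `|e i| = 1.
Proof.
apply/eqP; rewrite eq_le; apply/andP; split.
  by apply: norm_le_coord => // j; rewrite mxE eqxx /=; case: eqP => _; rewrite ?normr1 ?normr0.
by have := coord_le_norm (e i) i; rewrite mxE !eqxx normr1.
Qed.

(** By translation invariance the difference quotients of [u] have integral 0;
they are dominated because of the mean value theorem. *)
Lemma int_partial u i : Cc u -> (forall x, derivable u x (e i)) -> Cc (partial i u) ->
  (\int[mu]_x partial i u x = 0)%R.
Proof.
move=> cu du cdu.
have [C C0 HC] := Cc_bounded cdu.
pose h n : R := n.+1%:R^-1.
have h0 n : h n != 0 by rewrite invr_eq0 pnatr_eq0.
have h1 n : `|h n| <= 1 by rewrite ger0_norm ?invr_ge0// invf_le1 ?ltr0n// ler1n.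
pose f n x := (h n)^-1 * (u (x + h n *: e i) - u x) - partial i u x.
have cf n : Cc (f n).
  by apply: CcB => //; apply: CcZ; apply: CcB => //; exact: Cc_shift.
have If n : (\int[mu]_x f n x = - \int[mu]_x partial i u x)%R.
  rewrite /f Cc_intB ?Cc_intZ ?Cc_intB ?Cc_int_shift ?subrr ?mulr0 ?sub0r//.
  - exact: Cc_shift.
  - by apply: CcB => //; exact: Cc_shift.
  - by apply: CcZ; apply: CcB => //; exact: Cc_shift.
have [_ [B1 uB1]] := cu; have [_ [B2 uB2]] := cdu.
have := @Cc_int_cvg0 R N f (Num.max (B1 + 1) B2) (C + C).
have fcv : forall x, f ^~ x @ \oo --> 0.
  move=> x; rewrite -(subrr (partial i u x)); apply: cvgB; last exact: cvg_cst.
  by apply: diff_quotient_cvg => //; exact: cvg_harmonic.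
have fbd n x : `|f n x| <= C + C.
  apply: le_trans (ler_normB _ _) _; apply: lerD => //.
  have [s _ ->] := @MVT_line u x (e i) (h n) du.
  by rewrite mulKf//; exact: HC.
have fsupp n x : f n x != 0 -> `|x| <= Num.max (B1 + 1) B2.
  rewrite !le_max /f; have [->|/uB2 ->] := eqVneq (partial i u x) 0; last by rewrite orbT.
  rewrite subr0; have [->|/uB1 H _] := eqVneq (u x) 0.
    have [->|/uB1 H _] := eqVneq (u (x + h n *: e i)) 0; first by rewrite subrr mulr0 eqxx.
    apply/orP; left; rewrite -[x](addrK (h n *: e i)).
    by rewrite (le_trans (ler_normB _ _))// lerD// normrZ norm_delta_mx mulr1.
  by rewrite (le_trans H)// lerDl.
move=> /(_ (fun n => (cf n).1) fbd fsupp fcv).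
under eq_fun do rewrite If.
move=> /(cvg_lim (@Rhausdorff R)); rewrite lim_cst; last exact: Rhausdorff.
by move=> /eqP; rewrite oppr_eq0 => /eqP.
Qed.

Lemma derivableM_fun f g x (v : 'rV[R]_N) : derivable f x v -> derivable g x v ->
  derivable (fun y => f y * g y) x v.
Proof. exact: derivableM. Qed.

Lemma partialM f g x i : derivable f x (e i) -> derivable g x (e i) ->
  partial i (fun y => f y * g y) x = f x * partial i g x + partial i f x * g x.
Proof.
by move=> df dg; rewrite /partial (deriveM df dg) [X in _ + X]mulrC.
Qed.

Lemma Cc1_Cc f : Cc1 f -> Cc f. Proof. by case. Qed.
Lemma Cc1_derivable f i x : Cc1 f -> derivable f x (e i).
Proof. by case=> _ /(_ i)[]. Qed.
Lemma Cc1_partial f i : Cc1 f -> Cc (partial i f).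
Proof. by case=> _ /(_ i)[]. Qed.

Lemma int_by_parts f g i : Cc1 f -> Cc1 g ->
  (\int[mu]_x (partial i f x * g x) = - \int[mu]_x (f x * partial i g x))%R.
Proof.
move=> cf cg.
have cfg : Cc (fun x => f x * partial i g x).
  by apply: Cc_mulr; [exact: Cc1_Cc|exact: (Cc1_partial i cg).1].
have cgf : Cc (fun x => partial i f x * g x).
  by apply: Cc_mull; [exact: (Cc1_partial i cf).1|exact: Cc1_Cc].
have E : partial i (fun x => f x * g x) = fun x => f x * partial i g x + partial i f x * g x.
  by apply/funext => x; apply: partialM; exact: Cc1_derivable.
have := @int_partial (fun x => f x * g x) i.
rewrite E Cc_intD// => H; apply/eqP; rewrite -addr_eq0 addrC; apply/eqP; apply: H.
- by apply: Cc_mulr; [exact: Cc1_Cc|exact: (Cc1_Cc cg).1].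
- by move=> x; apply: derivableM_fun; exact: Cc1_derivable.
- exact: CcD.
Qed.

(** Both mixed derivatives are limits of the same second difference quotient,
by the mean value theorem applied once in each direction. *)
Lemma schwarz u i j x :
  (forall y, derivable u y (e i)) -> (forall y, derivable u y (e j)) ->
  (forall y, derivable (partial i u) y (e j)) ->
  (forall y, derivable (partial j u) y (e i)) ->
  continuous (partial j (partial i u)) -> continuous (partial i (partial j u)) ->
  partial j (partial i u) x = partial i (partial j u) x.
Proof.
move=> di dj dij dji cji cij.
have half (i1 i2 : 'I_N) (t : R) : 0 < t ->
  (forall y, derivable u y (e i1)) -> (forall y, derivable (partial i1 u) y (e i2)) ->
  exists2 y, `|y - x| <= t + t &
    (u (x + t *: e i1 + t *: e i2) - u (x + t *: e i1) - u (x + t *: e i2) + u x)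
     = t * (t * partial i2 (partial i1 u) y).
  move=> t0 d1 d2.
  pose w y := u (y + t *: e i2) - u y.
  have dw y : is_derive y (e i1) w (partial i1 u (y + t *: e i2) - partial i1 u y).
    have ds : is_derive y (e i1) (fun y => u (y + t *: e i2)) (partial i1 u (y + t *: e i2)).
      have E : (fun h : R => h^-1 *: (((fun y => u (y + t *: e i2)) \o shift y) (h *: e i1)
           - u (y + t *: e i2))) =
        (fun h : R => h^-1 *: ((u \o shift (y + t *: e i2)) (h *: e i1) - u (y + t *: e i2))).
        by apply/funext => h /=; rewrite addrA.
      by apply: DeriveDef; rewrite /derivable/partial/derive E//; exact: d1.
    by apply: is_deriveB; exact: derivableP.
  have [y|s st Es] := @MVT_line w x (e i1) t; first by have [] := dw y.
  have [r rt Er] := @MVT_line (partial i1 u) (x + s *: e i1) (e i2) t d2.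
  exists (x + s *: e i1 + r *: e i2).
    rewrite -[x + _ + _]addrA addrAC subrr add0r (le_trans (ler_normD _ _))// !normrZ !norm_delta_mx !mulr1.
    by move: st rt; rewrite (ger0_norm (ltW t0)) => st rt; exact: lerD.
  have -> : u (x + t *: e i1 + t *: e i2) - u (x + t *: e i1) - u (x + t *: e i2) + u x =
    w (x + t *: e i1) - w x by rewrite /w; ring.
  by rewrite Es; have [_ ->] := dw (x + s *: e i1); rewrite Er.
apply/eqP; rewrite -subr_eq0 -normr_eq0; apply/eqP/le_anti; rewrite normr_ge0 andbT.
apply/ler_addgt0Pr => eps eps0; rewrite add0r.
have e2 : 0 < eps / 2 by rewrite divr_gt0.
have /cvgrPdist_le/(_ _ e2)/nbhs_ballP[r1 /= r10 H1] := cji x.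
have /cvgrPdist_le/(_ _ e2)/nbhs_ballP[r2 /= r20 H2] := cij x.
pose t := Num.min r1 r2 / 4.
have m0 : 0 < Num.min r1 r2 by rewrite lt_min r10.
have t0 : 0 < t by rewrite divr_gt0.
have tr : t + t < Num.min r1 r2 by rewrite /t; lra.
have [y yt Ey] := half i j t t0 di dij.
have [z zt Ez] := half j i t t0 dj dji.
have yz : partial j (partial i u) y = partial i (partial j u) z.
  apply: (mulfI (lt0r_neq0 t0)); apply: (mulfI (lt0r_neq0 t0)).
  rewrite -Ey -Ez -[x + t *: e i + _]addrA [t *: e i + _]addrC addrA.
  by ring.
move: tr; rewrite lt_min => /andP[tr1 tr2].
have Hy : ball x r1 y by rewrite -ball_normE /= distrC (le_lt_trans yt).
have Hz : ball x r2 z by rewrite -ball_normE /= distrC (le_lt_trans zt).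
have := H1 _ Hy; have := H2 _ Hz; rewrite -yz.
move: (partial j (partial i u) x) (partial j (partial i u) y)
  (partial i (partial j u) x) => a b c h2 h1.
rewrite (_ : a - c = (a - b) - (c - b)); last by ring.
apply: (le_trans (ler_normB _ _)); rewrite [eps]splitr; exact: lerD.
Qed.

End coordinate_derivatives.

(** * Test functions and the integral of the squared Laplacian *)

Section test_functions.
Context {R : realType} {N : nat}.
Implicit Types (u f g : 'rV[R]_N -> R) (x : 'rV[R]_N) (i j : 'I_N).
Local Notation mu := (lebesgue_rV N).
Local Notation e i := (delta_mx ord0 i : 'rV[R]_N).

Lemma partial_support i u x : partial i u x != 0 -> closure [set y | u y != 0] x.
Proof. by move=> /eqP; apply: contra_notP; exact: derive_eq0_out_closure. Qed.

Lemma partials_support s u x : partials s u x != 0 -> closure [set y | u y != 0] x.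
Proof.
elim: s x => [|i s IH] x; first by move=> ux; apply: subset_closure.
move=> /partial_support; have /closure_id -> := @closed_closure _ [set y | u y != 0].
by apply: closureS => y /=; exact: IH.
Qed.

Variables (Omega : set 'rV[R]_N) (u : 'rV[R]_N -> R).
Hypothesis tu : test_function Omega u.

Lemma test_partials_Omega s x : partials s u x != 0 -> Omega x.
Proof. by move=> /partials_support; have [_ _] := tu; exact. Qed.

Lemma test_partials_Cc s : Cc (partials s u).
Proof.
have [su cu _] := tu; split; first exact: (su s).1.
have [M [_ HM]] := compact_bounded cu.
exists (M + 1) => x /partials_support Kx.
by apply: (HM (M + 1)) => //; rewrite ltrDl.
Qed.

Lemma test_partials_Cc1 s : Cc1 (partials s u).
Proof.
split; first exact: test_partials_Cc.
move=> i; split; last exact: (test_partials_Cc (i :: s)).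
by have [su _ _] := tu; have [_ H] := su s; exact: H.
Qed.

Lemma test_schwarz s i j x :
  partials [:: i, j & s] u x = partials [:: j, i & s] u x.
Proof.
have D t k y : derivable (partials t u) y (e k) by exact: Cc1_derivable (test_partials_Cc1 t).
have C t : continuous (partials t u) by exact: (test_partials_Cc t).1.
apply: (@schwarz _ _ (partials s u)).
- exact: (D s j).
- exact: (D s i).
- exact: (D (j :: s) i).
- exact: (D (i :: s) j).
- exact: (C [:: i, j & s]).
- exact: (C [:: j, i & s]).
Qed.

(** Two integrations by parts and the symmetry of third derivatives move
D_ii u * D_kk u to (D_ik u)^2. *)
Lemma int_laplacian_sqr :
  (\int[mu]_x (laplacian u x ^+ 2) =
   \sum_(k < N) \sum_(i < N) \int[mu]_x (partial i (partial k u) x ^+ 2))%R.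
Proof.
have cp2 i j k l : Cc (fun x => partials [:: i; j] u x * partials [:: k; l] u x).
  apply: Cc_mulr; first exact: test_partials_Cc.
  exact: (test_partials_Cc _).1.
have -> : (\int[mu]_x (laplacian u x ^+ 2) = \int[mu]_x
  \sum_(k < N) \sum_(i < N) (partials [:: i; i] u x * partials [:: k; k] u x))%R.
  apply: eq_Rintegral => x _; rewrite expr2 /laplacian mulr_sumr; apply: eq_bigr => k _.
  by rewrite mulr_suml.
rewrite Cc_int_sum; last by move=> k _; apply: Cc_sum => i _; exact: cp2.
apply: eq_bigr => k _; rewrite Cc_int_sum; last by move=> i _; exact: cp2.
apply: eq_bigr => i _.
have c1 t := test_partials_Cc1 t.
have H1 := int_by_parts i (c1 [:: i]) (c1 [:: k; k]).
have H2 := int_by_parts k (c1 [:: i; k]) (c1 [:: i]).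
have E1 x : partial i (partials [:: k; k] u) x = partial k (partials [:: i; k] u) x.
  exact: (test_schwarz [:: k]).
have E2 x : partial k (partials [:: i] u) x = partials [:: i; k] u x.
  exact: (test_schwarz [::]).
apply: (etrans H1).
under eq_Rintegral do rewrite E1 mulrC.
apply: (etrans (congr1 -%R H2)).
by rewrite opprK; apply: eq_Rintegral => x _; rewrite E2 -expr2.
Qed.

End test_functions.

(** * Continuous and differentiable functions of one variable *)

Section real_lemmas.
Context {R : realType}.

(** A mean value theorem where the two points come in either order, as the
values of the distance do along a step. *)
Lemma MVT_between (g g' : R -> R) (a b s t : R) :
  (forall r, a <= r <= b -> is_derive r 1 g (g' r)) ->
  a <= s <= b -> a <= t <= b ->
  exists r, [/\ a <= r <= b, `|r - s| <= `|t - s| & g t - g s = g' r * (t - s)].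
Proof.
move=> dg /andP[as_ sb] /andP[at_ tb].
have key (c d : R) : a <= c -> d <= b -> c <= d ->
    exists r, [/\ c <= r <= d, a <= r <= b & g d - g c = g' r * (d - c)].
  move=> ac db cd.
  have dg' r : r \in `]c, d[ -> is_derive r 1 g (g' r).
    by rewrite in_itv/= => /andP[cr rd]; apply: dg; lra.
  have cg : {within `[c, d], continuous g}.
    apply: derivable_within_continuous => r; rewrite in_itv/= => /andP[cr rd].
    by have [] := dg r ltac:(lra).
  have [r + E] := MVT_segment cd dg' cg; rewrite in_itv/= => /andP[cr rd].
  by exists r; split; [rewrite cr|lra|].
have [st|/ltW ts] := leP s t.
  have [r [/andP[sr rt] abr E]] := key s t as_ tb st.
  by exists r; split => //; rewrite !ger0_norm; lra.
have [r [/andP[tr rs] abr E]] := key t s at_ sb ts.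
exists r; split => //; first by rewrite !ler0_norm; lra.
by rewrite -opprB E -mulrN opprB.
Qed.

Lemma continuous_itv_bounded (f : R -> R) (a b : R) :
  (forall s, a <= s <= b -> {for s, continuous f}) ->
  exists2 C, 0 <= C & forall s, a <= s <= b -> `|f s| <= C.
Proof.
move=> cf; have [ab|ba] := leP a b; last first.
  by exists 0 => // s /andP[as_ sb]; have := le_trans as_ sb; rewrite leNgt ba.
have cnf : {within `[a, b], continuous (fun s => `|f s|)}.
  apply: continuous_in_subspaceT => s; rewrite inE /= in_itv/= => sab.
  by apply: continuous_comp; [exact: cf|exact: norm_continuous].
have [c _ Hc] := EVT_max ab cnf.
by exists `|f c| => // s sab; apply: Hc; rewrite in_itv.
Qed.

Lemma cvg0_le (f g : nat -> R) : g @ \oo --> 0 -> (forall n, `|f n| <= `|g n|) ->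
  f @ \oo --> 0.
Proof.
move=> g0 fg; apply/norm_cvg0P.
apply: (@squeeze_cvgr _ _ _ _ (fun=> 0) (fun n => `|g n|)).
- by apply: nearW => n; rewrite normr_ge0 fg.
- exact: cvg_cst.
- by apply/norm_cvg0P.
Qed.

End real_lemmas.

Section continuity.
Context {R : realType} {N : nat}.
Implicit Types f g : 'rV[R]_N -> R.

Lemma continuous_funM f g : continuous f -> continuous g -> continuous (fun x => f x * g x).
Proof. by move=> cf cg x; apply: continuousM; [exact: cf|exact: cg]. Qed.

Lemma continuous_funD f g : continuous f -> continuous g -> continuous (fun x => f x + g x).
Proof. by move=> cf cg x; apply: continuousD; [exact: cf|exact: cg]. Qed.

Lemma continuous_funB f g : continuous f -> continuous g -> continuous (fun x => f x - g x).
Proof. by move=> cf cg x; apply: continuousB; [exact: cf|exact: cg]. Qed.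

Lemma continuous_funZ a f : continuous f -> continuous (fun x => a * f x).
Proof. by apply: (@continuous_funM (fun=> a)); exact: cst_continuous. Qed.

Lemma continuous_itv_comp (F : R -> R) f (a b : R) :
  (forall s, a <= s <= b -> {for s, continuous F}) ->
  (forall x, a <= f x <= b) -> continuous f -> continuous (fun x => F (f x)).
Proof. by move=> cF fab cf x; apply: continuous_comp; [exact: cf|exact/cF/fab]. Qed.

End continuity.

(** * The weighted Hardy inequality *)

(** Here [rho] stands for the distance to the boundary.  The hypothesis
[rho_sup] is what remains of its concavity and of the eikonal equation
|grad rho| = 1 when no derivative of [rho] is available: at every point of the
support of [v] there is a supergradient of length 1. *)
Section concave_weight.
Context {R : realType} {N : nat}.
Implicit Types (x : 'rV[R]_N) (i j : 'I_N).
Local Notation mu := (lebesgue_rV N).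
Local Notation e i := (delta_mx ord0 i : 'rV[R]_N).
Variables (v rho : 'rV[R]_N -> R) (kappa M eta : R).
Hypothesis cv : Cc1 v.
Hypothesis crho : continuous rho.
Hypothesis rho_itv : forall x, kappa <= rho x <= M.
Hypothesis rho_lip : forall x i h, `|rho (x + h *: e i) - rho x| <= `|h|.
Hypothesis eta0 : 0 < eta.
Hypothesis rho_sup : forall x, v x != 0 -> exists2 nu : 'I_N -> R,
  \sum_i nu i ^+ 2 = 1 &
  forall i t, `|t| <= eta -> rho (x + t *: e i) <= rho x + t * nu i.

(* The steps stay below eta, so that rho_sup applies to each of them. *)
Let h n : R := eta * n.+1%:R^-1.

Let h_gt0 n : 0 < h n. Proof. by rewrite mulr_gt0// invr_gt0. Qed.

Let h_neq0 n : h n != 0. Proof. by rewrite gt_eqF. Qed.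

Let h_le n : `|h n| <= eta.
Proof. by rewrite gtr0_norm// ler_piMr ?(ltW eta0)// invf_le1 ?ltr0n// ler1n. Qed.

Let h_cvg : h @ \oo --> 0.
Proof. by rewrite -(mulr0 eta); apply: cvgMr; exact: cvg_harmonic. Qed.

Let q x := v x * v x.

Let cq : Cc1 q.
Proof.
split; first by apply: Cc_mulr; [exact: Cc1_Cc|exact: (Cc1_Cc cv).1].
move=> i; split; first by move=> x; apply: derivableM_fun; exact: Cc1_derivable.
have -> : partial i q = fun x => v x * partial i v x + partial i v x * v x.
  by apply/funext => x; apply: partialM; exact: Cc1_derivable.
by apply: CcD; [apply: Cc_mulr|apply: Cc_mull];
  rewrite ?(Cc1_Cc cv)//; (exact: (Cc1_partial i cv).1 || exact: (Cc1_Cc cv).1 ||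
  exact: Cc1_Cc).
Qed.

Let partialq i x : partial i q x = 2 * v x * partial i v x.
Proof. by rewrite /q partialM; [ring|exact: Cc1_derivable|exact: Cc1_derivable]. Qed.

(* The opposite second difference d2 is the backward quotient minus the forward
   quotient f; a supergradient nu lies between the two. *)
Let f n i x := (h n)^-1 * (rho (x + h n *: e i) - rho x).
Let d2 n i x := (h n)^-1 * (2 * rho x - rho (x + h n *: e i) - rho (x - h n *: e i)).

Let f_le1 n i x : `|f n i x| <= 1.
Proof.
rewrite /f normrM normfV mulrC ler_pdivrMr ?normr_gt0// mul1r.
exact: rho_lip.
Qed.

Let cont_f n i : continuous (f n i).
Proof. by apply: continuous_funZ; apply: continuous_funB => //; exact: continuous_translate. Qed.

Let cont_d2 n i : continuous (d2 n i).
Proof.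
apply: continuous_funZ; apply: continuous_funB; last exact: continuous_translate.
by apply: continuous_funB; [exact: continuous_funZ|exact: continuous_translate].
Qed.

(** The second difference of the merely Lipschitz [rho] does not tend to 0
pointwise, but a translation of the variable moves it onto [q], whose forward
and backward quotients have the same limit. *)
Lemma int_second_difference i :
  ((\int[mu]_x (q x * d2 n i x))%R @[n --> \oo] --> 0).
Proof.
pose T n x := (h n)^-1 * (2 * q x - q (x - h n *: e i) - q (x + h n *: e i)).
have cqq := Cc1_Cc cq.
have cT n : Cc (T n).
  apply: CcZ; apply: CcB; last exact: Cc_shift.
  by apply: CcB; [exact: CcZ|exact: (Cc_shift (- (h n *: e i)) cqq)].
have E n : (\int[mu]_x (q x * d2 n i x) = \int[mu]_x (rho x * T n x))%R.
  have c1 a : Cc (fun x => q x * rho (x + a)).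
    by apply: Cc_mulr => //; exact: continuous_translate.
  have c2 a : Cc (fun x => rho x * q (x + a)).
    by apply: Cc_mull => //; exact: Cc_shift.
  have c0 : Cc (fun x => q x * rho x) by exact: Cc_mulr.
  have sh a : (\int[mu]_x (q x * rho (x + a)) = \int[mu]_x (rho x * q (x - a)))%R.
    rewrite -(Cc_int_shift (- a) (c1 a)); apply: eq_Rintegral => x _.
    by rewrite subrK mulrC.
  rewrite (_ : (fun x => q x * d2 n i x) = fun x => (h n)^-1 *
    (2 * (q x * rho x) - q x * rho (x + h n *: e i) - q x * rho (x + (- (h n *: e i)))));
    last by apply/funext => x; rewrite /d2; ring.
  rewrite (_ : (fun x => rho x * T n x) = fun x => (h n)^-1 *
    (2 * (q x * rho x) - rho x * q (x - h n *: e i) - rho x * q (x + h n *: e i)));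
    last by apply/funext => x; rewrite /T; ring.
  rewrite !Cc_intZ; [|apply: CcB => //; apply: CcB => //; exact: CcZ..].
  rewrite !Cc_intB//; [|exact: CcZ|by apply: CcB => //; exact: CcZ|exact: CcZ|by apply: CcB => //; exact: CcZ].
  by rewrite !sh opprK.
under eq_fun do rewrite E.
have [C C0 HC] := Cc_bounded (Cc1_partial i cq).
have [_ [B qB]] := cqq.
have rhoK x : `|rho x| <= `|kappa| + `|M|.
  have /andP[a b] := rho_itv x.
  rewrite ler_norml; have := ler_norm M; have := lerNnormlW (lexx `|kappa|).
  by have := normr_ge0 kappa; have := normr_ge0 M; lra.
have dqC x (t : R) : t != 0 -> `|t^-1 * (q (x + t *: e i) - q x)| <= C.
  have dq y : derivable q y (e i) by exact: Cc1_derivable.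
  move=> t0; have [s _ ->] := MVT_line x t dq.
  by rewrite mulKf//; exact: HC.
have TE n x : T n x = (- h n)^-1 * (q (x + (- h n) *: e i) - q x)
    - (h n)^-1 * (q (x + h n *: e i) - q x).
  by rewrite /T scaleNr invrN; ring.
have Nh0 n : - h n != 0 by rewrite oppr_eq0.
apply: (@Cc_int_cvg0 _ _ _ (B + eta) ((`|kappa| + `|M|) * (C + C))).
- by move=> n; apply: (Cc_mull crho (cT n)).1.
- move=> n x; rewrite normrM; apply: ler_pM => //.
  rewrite TE; apply: le_trans (ler_normB _ _) _.
  by apply: lerD; exact: dqC.
- move=> n x H; have [q1|/qB xB] := eqVneq (q x) 0; last first.
    by rewrite (le_trans xB)// lerDl ltW.
  have shB t : `|t| <= eta -> q (x + t *: e i) != 0 -> `|x| <= B + eta.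
    move=> teta /qB xB; rewrite -[x](addrK (t *: e i)).
    by rewrite (le_trans (ler_normB _ _))// lerD// normrZ norm_delta_mx mulr1.
  have [q2|] := eqVneq (q (x + h n *: e i)) 0; last exact: shB.
  have [q3|] := eqVneq (q (x + (- h n) *: e i)) 0; last by apply: shB; rewrite normrN.
  by move: H; rewrite TE q1 q2 q3 !subrr !mulr0 subrr mulr0 eqxx.
- move=> x; rewrite -(mulr0 (rho x)); apply: cvgMr.
  rewrite -(subrr (partial i q x)); under eq_fun do rewrite TE.
  have dq : derivable q x (e i) by exact: Cc1_derivable.
  apply: cvgB; apply: diff_quotient_cvg => //.
  by rewrite -oppr0; exact: cvgN.
Qed.

Variables (g g' w : R -> R).
Hypothesis dg : forall s, kappa <= s <= M -> is_derive s 1 g (g' s).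
Hypothesis cg' : forall s, kappa <= s <= M -> {for s, continuous g'}.
Hypothesis cw : forall s, kappa <= s <= M -> {for s, continuous w}.
Hypothesis g_ge0 : forall s, kappa <= s <= M -> 0 <= g s.
Hypothesis w_gt0 : forall s, kappa <= s <= M -> 0 < w s.

Let cg s : kappa <= s <= M -> {for s, continuous g}.
Proof.
by move=> /dg[dgs _]; apply: differentiable_continuous; exact/derivable1_diffP.
Qed.

Let G x := g (rho x).
Let c s := g' s + g s ^+ 2 / w s.

Let cont_c s : kappa <= s <= M -> {for s, continuous c}.
Proof.
move=> sI; apply: continuousD; first exact: cg'.
apply: continuousM; first by apply: continuousM; exact: cg.
by apply: continuousV; [rewrite gt_eqF ?w_gt0|exact: cw].
Qed.

Let cont_G : continuous G. Proof. exact: (continuous_itv_comp cg rho_itv crho). Qed.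

Let F n i x := q x * G x * f n i x.

Let Cc_F n i : Cc (F n i).
Proof.
by apply: Cc_mulr; [apply: Cc_mulr; [exact: Cc1_Cc|exact: cont_G]|exact: cont_f].
Qed.

(* The remainder in the product and chain rules that would give the derivative
   of q * g(rho) along e i; the slope of rho is the quotient f itself. *)
Let rem n i x :=
  ((h n)^-1 * (q (x + h n *: e i) - q x) * G (x + h n *: e i) - partial i q x * G x)
  + q x * ((h n)^-1 * (G (x + h n *: e i) - G x) - g' (rho x) * f n i x).

Let q_ge0 x : 0 <= q x. Proof. by rewrite /q -expr2 sqr_ge0. Qed.

Let q_neq0 x : (q x != 0) = (v x != 0).
Proof. by rewrite /q mulf_eq0 orbb. Qed.

(** This is where concavity enters: the forward quotient of [rho] does not
increase along a line, so differentiating the factor [f] of [F] only helps. *)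
Let F_increment n i x :
  (h n)^-1 * (F n i (x + h n *: e i) - F n i x) <=
  f n i x * rem n i x
  + f n i x * (partial i q x * G x + q x * g' (rho x) * f n i x).
Proof.
set y := x + h n *: e i.
have fy : q y * G y * (f n i y - f n i x) <= 0.
  have [q0|] := eqVneq (q y) 0; first by rewrite q0 !mul0r.
  rewrite q_neq0 => /rho_sup[nu _ nuP].
  rewrite mulr_ge0_le0//; first by rewrite mulr_ge0 ?q_ge0// g_ge0.
  have xE : x = y + (- h n) *: e i by rewrite /y scaleNr addrK.
  have h1 := nuP i (h n) (h_le n).
  have h2 := nuP i (- h n); rewrite -xE normrN in h2; have {}h2 := h2 (h_le n).
  rewrite /f -/y -mulrBr mulr_ge0_le0 ?invr_ge0 ?(ltW (h_gt0 n))//.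
  by lra.
rewrite -subr_ge0.
have -> : f n i x * rem n i x + f n i x * (partial i q x * G x + q x * g' (rho x) * f n i x)
    - (h n)^-1 * (F n i y - F n i x) = (h n)^-1 * - (q y * G y * (f n i y - f n i x)).
  by rewrite /rem /F -/y; ring.
by rewrite mulr_ge0 ?invr_ge0 ?(ltW (h_gt0 n))// oppr_ge0.
Qed.

(* Since |f| <= 1, the chain rule for g(rho) is uniform in the slope f, which
   need not converge. *)
Let rem_cvg i x : (f n i x * rem n i x) @[n --> \oo] --> 0.
Proof.
have cvs (k : 'rV[R]_N -> R) : continuous k -> k (x + h n *: e i) @[n --> \oo] --> k x.
  move=> ck; have xc : x + h n *: e i @[n --> \oo] --> x + 0 *: e i.
    by apply: cvgD; [exact: cvg_cst|apply: cvgZr_tmp; exact: h_cvg].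
  by rewrite scale0r addr0 in xc; exact: (cvg_comp _ _ xc (ck x)).
have r0 : rem n i x @[n --> \oo] --> 0.
  rewrite -(addr0 (0 : R)); apply: cvgD.
    rewrite -(subrr (partial i q x * G x)); apply: cvgB; last exact: cvg_cst.
    apply: cvgM; last exact: cvs.
    by apply: diff_quotient_cvg => //; exact: Cc1_derivable.
  rewrite -(mulr0 (q x)); apply: cvgMr.
  have Hr n := MVT_between dg (rho_itv x) (rho_itv (x + h n *: e i)).
  have [r Hr'] := choice Hr.
  have rc : r @ \oo --> rho x.
    apply/subr_cvg0; apply: (cvg0_le (g := fun n => rho (x + h n *: e i) - rho x)).
      by apply/subr_cvg0; exact: cvs.
    by move=> n; have [] := Hr' n.
  apply: (cvg0_le (g := fun n => g' (r n) - g' (rho x))).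
    apply/subr_cvg0; apply: (@cvg_comp _ _ _ r g'); first exact: rc.
    exact: cg'.
  move=> n; have [_ _ E] := Hr' n; rewrite /G E.
  have -> : (h n)^-1 * (g' (r n) * (rho (x + h n *: e i) - rho x)) - g' (rho x) * f n i x
     = (g' (r n) - g' (rho x)) * f n i x by rewrite /f; ring.
  by rewrite normrM ler_piMr.
apply: (cvg0_le (g := fun n => rem n i x)) => // n.
by rewrite normrM ler_piMl.
Qed.

Let rem_bounded i : exists C, forall n x, `|f n i x * rem n i x| <= C.
Proof.
have [C1 C10 HC1] := Cc_bounded (Cc1_partial i cq).
have [C2 C20 HC2] := continuous_itv_bounded cg.
have [C3 C30 HC3] := continuous_itv_bounded cg'.
have [C4 C40 HC4] := Cc_bounded (Cc1_Cc cq).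
exists (C1 * C2 + C1 * C2 + C4 * (C3 + C3)) => n x.
have H : `|rem n i x| <= C1 * C2 + C1 * C2 + C4 * (C3 + C3).
  apply: le_trans (ler_normD _ _) _; apply: lerD.
    apply: le_trans (ler_normB _ _) _; apply: lerD; rewrite normrM; apply: ler_pM => //.
    - have dq y : derivable q y (e i) by exact: Cc1_derivable.
      by have [s _ ->] := MVT_line x (h n) dq; rewrite mulKf//; exact: HC1.
    - exact: HC2.
    - exact: HC2.
  rewrite normrM; apply: ler_pM => //.
  have [r [rI _ E]] := MVT_between dg (rho_itv x) (rho_itv (x + h n *: e i)).
  rewrite /G E.
  have -> : (h n)^-1 * (g' r * (rho (x + h n *: e i) - rho x)) - g' (rho x) * f n i x
     = g' r * f n i x - g' (rho x) * f n i x by rewrite /f; ring.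
  apply: le_trans (ler_normB _ _) _; apply: lerD.
    by rewrite normrM (le_trans (ler_piMr _ (f_le1 n i x)))// HC3.
  by rewrite normrM (le_trans (ler_piMr _ (f_le1 n i x)))// HC3.
by rewrite normrM (le_trans (ler_piMl _ (f_le1 n i x))).
Qed.

Let Cc_rem n i : Cc (fun x => f n i x * rem n i x).
Proof.
have ccq := Cc1_Cc cq; have ccdq := Cc1_partial i cq.
apply: Cc_mull; first exact: cont_f.
apply: CcD.
  apply: CcB; last exact: Cc_mulr.
  apply: Cc_mulr; last exact: continuous_translate.
  by apply: CcZ; apply: CcB => //; exact: Cc_shift.
apply: Cc_mulr => //; apply: continuous_funB.
  by apply: continuous_funZ; apply: continuous_funB => //; exact: continuous_translate.
by apply: continuous_funM => //; exact: (continuous_itv_comp cg' rho_itv crho).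
Qed.

Let int_rem i : ((\int[mu]_x (f n i x * rem n i x))%R @[n --> \oo] --> 0).
Proof.
have [C HC] := rem_bounded i.
have [_ [B qB]] := Cc1_Cc cq; have [_ [B' dqB]] := Cc1_partial i cq.
apply: (@Cc_int_cvg0 _ _ _ (Num.max (B + eta) B') C) => //.
- by move=> n; exact: (Cc_rem n i).1.
- move=> n x H; rewrite le_max.
  have [q1|/qB xB] := eqVneq (q x) 0; last by rewrite (le_trans xB)// lerDl ltW.
  have [d1|/dqB ->] := eqVneq (partial i q x) 0; last by rewrite orbT.
  have [q2|/qB xB] := eqVneq (q (x + h n *: e i)) 0.
    by move: H; rewrite /rem q1 q2 d1 subrr !(mulr0,mul0r) subrr addr0 mulr0 eqxx.
  apply/orP; left; rewrite -[x](addrK (h n *: e i)).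
  by rewrite (le_trans (ler_normB _ _))// lerD// normrZ norm_delta_mx mulr1.
Qed.

(** The inequality under the integral sign, at a fixed step.  The square
completed in [H1] uses the slopes [f] instead of a gradient of length 1; their
squares add up to 1 only up to the second differences [d2], which is [H2]. *)
Let pointwise C n x : (forall s, kappa <= s <= M -> `|c s| <= C) ->
  \sum_i ((h n)^-1 * (F n i (x + h n *: e i) - F n i x)
          - f n i x * rem n i x - (C + C) * (q x * d2 n i x)) <=
  w (rho x) * (\sum_i partial i v x ^+ 2) + q x * c (rho x).
Proof.
move=> HC; have w0 := w_gt0 (rho_itv x).
have H1 i : (h n)^-1 * (F n i (x + h n *: e i) - F n i x) - f n i x * rem n i x <=
    w (rho x) * partial i v x ^+ 2 + q x * c (rho x) * f n i x ^+ 2.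
  have := F_increment n i x; rewrite -lerBlDl => /le_trans; apply.
  rewrite partialq -subr_ge0.
  have -> : w (rho x) * partial i v x ^+ 2 + q x * c (rho x) * f n i x ^+ 2 -
     f n i x * (2 * v x * partial i v x * G x + q x * g' (rho x) * f n i x) =
     (w (rho x) * partial i v x - v x * G x * f n i x) ^+ 2 / w (rho x).
    by rewrite /c /q -/(G x); field; rewrite gt_eqF.
  by rewrite divr_ge0 ?sqr_ge0// ltW.
have H2 : q x * c (rho x) * (\sum_i f n i x ^+ 2 - 1) <=
    \sum_i (C + C) * (q x * d2 n i x).
  have [q0|] := eqVneq (q x) 0.
    by rewrite q0 !mul0r; apply: sumr_ge0 => i _; rewrite mul0r mulr0.
  rewrite q_neq0 => /rho_sup[nu nu1 nuP].
  rewrite -nu1 -sumrB mulr_sumr; apply: ler_sum => i _.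
  have Hn := nuP i (h n) (h_le n).
  have := nuP i (- h n); rewrite normrN mulNr scaleNr => /(_ (h_le n)) Hn'.
  have fnu : f n i x <= nu i.
    by rewrite /f mulrC ler_pdivrMr// mulrC; lra.
  have nuf : nu i <= f n i x + d2 n i x.
    have -> : f n i x + d2 n i x = (h n)^-1 * (rho x - rho (x - h n *: e i)).
      by rewrite /f /d2; ring.
    by rewrite mulrC ler_pdivlMr// mulrC; lra.
  have nui1 : `|nu i| <= 1.
    rewrite -(@ler_sqr _ `|nu i|) ?nnegrE// expr1n real_normK ?num_real//.
    by rewrite -nu1 (bigD1 i)//= lerDl sumr_ge0// => j _; rewrite sqr_ge0.
  have fi1 := f_le1 n i x.
  have sq : `|f n i x ^+ 2 - nu i ^+ 2| <= 2 * d2 n i x.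
    rewrite subr_sqr normrM mulrC; apply: ler_pM => //.
      by rewrite (le_trans (ler_normD _ _))// lerD.
    by rewrite ler_norml; lra.
  have d20 : 0 <= d2 n i x by lra.
  rewrite (le_trans (ler_norm _))// normrM normrM (ger0_norm (q_ge0 x)).
  have -> : (C + C) * (q x * d2 n i x) = q x * C * (2 * d2 n i x) by ring.
  apply: ler_pM => //; first by rewrite mulr_ge0.
  by rewrite ler_wpM2l// HC.
rewrite sumrB; apply: le_trans (lerB (ler_sum _ (fun i _ => H1 i)) (lexx _)) _.
rewrite big_split /= -mulr_sumr -mulr_sumr lerBlDr.
by move: H2; rewrite mulrBr mulr1; lra.
Qed.

(** Integrate [pointwise]: the increments of [F] have integral 0, and the two
error terms vanish with the step. *)
Lemma weighted_hardy :
  (\int[mu]_x ((- g' (rho x) - g (rho x) ^+ 2 / w (rho x)) * v x ^+ 2) <=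
   \int[mu]_x (w (rho x) * (\sum_i partial i v x ^+ 2)))%R.
Proof.
have [C C0 HC] := continuous_itv_bounded cont_c.
have Cc1' : Cc (fun x => w (rho x) * (\sum_i partial i v x ^+ 2)).
  apply: Cc_mull; first exact: (continuous_itv_comp cw rho_itv crho).
  apply: Cc_sum => i _; have cdv := Cc1_partial i cv.
  by apply: Cc_mulr => //; exact: cdv.1.
have cc2 : Cc (fun x => q x * c (rho x)).
  by apply: Cc_mulr; [exact: Cc1_Cc|exact: (continuous_itv_comp cont_c rho_itv crho)].
have cc3 n i : Cc (fun x => (h n)^-1 * (F n i (x + h n *: e i) - F n i x)).
  by apply: CcZ; apply: CcB => //; exact: Cc_shift.
have cc4 n i : Cc (fun x => (C + C) * (q x * d2 n i x)).
  by apply: CcZ; apply: Cc_mulr; [exact: Cc1_Cc|exact: cont_d2].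
have cc5 n i : Cc (fun x => (h n)^-1 * (F n i (x + h n *: e i) - F n i x)
          - f n i x * rem n i x - (C + C) * (q x * d2 n i x)).
  by do 2 apply: CcB => //.
rewrite (_ : (fun x => _ * v x ^+ 2) = fun x => - 1 * (q x * c (rho x))); last first.
  by apply/funext => x; rewrite /q /c; ring.
rewrite Cc_intZ// mulN1r -subr_ge0 opprK -Cc_intD//.
have H n : - \sum_i (\int[mu]_x (f n i x * rem n i x)
      + (C + C) * \int[mu]_x (q x * d2 n i x))%R <=
    (\int[mu]_x (w (rho x) * (\sum_i partial i v x ^+ 2) + q x * c (rho x)))%R.
  have ccs : Cc (fun x => \sum_i ((h n)^-1 * (F n i (x + h n *: e i) - F n i x)
          - f n i x * rem n i x - (C + C) * (q x * d2 n i x))).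
    by apply: Cc_sum => i _; exact: cc5.
  have := Cc_int_le ccs (CcD Cc1' cc2) (fun x => pointwise n x HC).
  apply: le_trans; rewrite Cc_int_sum; last by move=> i _; exact: cc5.
  rewrite -sumrN; apply: ler_sum => i _.
  rewrite Cc_intB//; last by apply: CcB.
  rewrite Cc_intB// Cc_intZ; last by apply: CcB => //; exact: Cc_shift.
  rewrite Cc_intB//; last exact: Cc_shift.
  rewrite Cc_int_shift// subrr mulr0 sub0r Cc_intZ ?opprD//.
  by apply: Cc_mulr; [exact: Cc1_Cc|exact: cont_d2].
have L : \sum_i (\int[mu]_x (f n i x * rem n i x)
      + (C + C) * \int[mu]_x (q x * d2 n i x))%R @[n --> \oo] --> \sum_(i < N) (0 : R).
  apply: cvg_big => [|i _]; first exact: add_continuous.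
  rewrite -(addr0 (0 : R)); apply: cvgD; first exact: int_rem.
  by rewrite -(mulr0 (C + C)); apply: cvgMr; exact: int_second_difference.
have := cvgN L; rewrite big1_eq oppr0 => {}L.
by apply: (ler_cvg_to (L _) (cvg_cst _)); exact: nearW.
Qed.

End concave_weight.

(** * Sums of products of iterated logarithms *)

Section iterated_logarithms.
Context {R : realType}.
Implicit Types (s t : R) (n : nat).

Lemma is_derive_funD (f g : R -> R) s a b : is_derive s 1 f a -> is_derive s 1 g b ->
  is_derive s 1 (fun x => f x + g x) (a + b).
Proof. by move=> fa gb; exact: is_deriveD. Qed.

Lemma is_derive_funM (f g : R -> R) s a b : is_derive s 1 f a -> is_derive s 1 g b ->
  is_derive s 1 (fun x => f x * g x) (a * g s + f s * b).
Proof.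
move=> fa gb; apply: (is_derive_eq (is_deriveM fa gb)).
by rewrite addrC [a * _]mulrC.
Qed.

Lemma is_derive_funN (f : R -> R) s a : is_derive s 1 f a -> is_derive s 1 (fun x => - f x) (- a).
Proof. exact: is_deriveN. Qed.

Lemma is_derive_funV (f : R -> R) s a : is_derive s 1 f a -> f s != 0 ->
  is_derive s 1 (fun x => (f x)^-1) (- a / f s ^+ 2).
Proof.
move=> fa fs; apply: (is_derive_eq (is_deriveV fs fa)).
by rewrite mulNr [RHS](_ : _ = - (f s ^- 2) * a)//; ring.
Qed.

Lemma is_derive_var s : is_derive s 1 (fun x : R => x) 1.
Proof. exact: is_derive_id. Qed.

Lemma is_derive_const a s : is_derive s 1 (fun=> a : R) 0.
Proof. exact: is_derive_cst. Qed.

Lemma is_derive_continuous (f : R -> R) s a : is_derive s 1 f a -> {for s, continuous f}.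
Proof. by move=> [fs _]; apply: differentiable_continuous; exact/derivable1_diffP. Qed.

Lemma is_derive_fun_comp (f g : R -> R) s a b : is_derive (g s) 1 f a -> is_derive s 1 g b ->
  is_derive s 1 (fun x => f (g x)) (a * b).
Proof. exact: is_derive1_comp. Qed.

Lemma continuous_at_const (k : R) s : {for s, continuous (fun=> k : R)}.
Proof. exact: cst_continuous. Qed.
Arguments continuous_at_const : clear implicits.

Lemma continuous_at_funD (f g : R -> R) s : {for s, continuous f} -> {for s, continuous g} ->
  {for s, continuous (fun x => f x + g x)}.
Proof. exact: continuousD. Qed.

Lemma continuous_at_funN (f : R -> R) s : {for s, continuous f} -> {for s, continuous (fun x => - f x)}.
Proof. exact: continuousN. Qed.

Lemma continuous_at_funM (f g : R -> R) s : {for s, continuous f} -> {for s, continuous g} ->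
  {for s, continuous (fun x => f x * g x)}.
Proof. exact: continuousM. Qed.

Lemma continuous_at_funX2 (f : R -> R) s : {for s, continuous f} -> {for s, continuous (fun x => f x ^+ 2)}.
Proof. by move=> cf; exact: (continuous_at_funM cf cf). Qed.

(** [logprod i] is X_1 ... X_i, and [logsum n], [logsum2 n] are the sums B and S
of the first n of these products and of their squares.  The sum [logsum3 n] is
half of t d/dt S, see [is_derive_logsum2]. *)
Definition logprod n t := \prod_(1 <= j < n.+1) iterlog j t.
Definition logsum n t := \sum_(1 <= i < n.+1) logprod i t.
Definition logsum2 n t := \sum_(1 <= i < n.+1) logprod i t ^+ 2.
Definition logsum3 n t := \sum_(1 <= i < n.+1) logprod i t ^+ 2 * logsum i t.

Lemma logprod0 t : logprod 0 t = 1. Proof. by rewrite /logprod big_geq. Qed.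
Lemma logsum0 t : logsum 0 t = 0. Proof. by rewrite /logsum big_geq. Qed.
Lemma logsum20 t : logsum2 0 t = 0. Proof. by rewrite /logsum2 big_geq. Qed.
Lemma logsum30 t : logsum3 0 t = 0. Proof. by rewrite /logsum3 big_geq. Qed.

Lemma logprodS n t : logprod n.+1 t = logprod n t * iterlog n.+1 t.
Proof. by rewrite /logprod big_nat_recr. Qed.
Lemma logsumS n t : logsum n.+1 t = logsum n t + logprod n.+1 t.
Proof. by rewrite /logsum big_nat_recr. Qed.
Lemma logsum2S n t : logsum2 n.+1 t = logsum2 n t + logprod n.+1 t ^+ 2.
Proof. by rewrite /logsum2 big_nat_recr. Qed.
Lemma logsum3S n t :
  logsum3 n.+1 t = logsum3 n t + logprod n.+1 t ^+ 2 * logsum n.+1 t.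
Proof. by rewrite /logsum3 big_nat_recr. Qed.

Lemma X1_itv t : 0 < t < 1 -> 0 < X1 t < 1.
Proof.
move=> /ln_lt0 l; rewrite /X1 invr_gt0 invf_lt1; last by lra.
by apply/andP; split; lra.
Qed.

Lemma iterlog_itv n t : 0 < t < 1 -> 0 < iterlog n t < 1.
Proof. by move=> t01; elim: n => [//|n IH] /=; exact: X1_itv. Qed.

Lemma logprod_gt0 n t : 0 < t < 1 -> 0 < logprod n t.
Proof.
move=> t01; elim: n => [|n IH]; first by rewrite logprod0.
by rewrite logprodS mulr_gt0//; have /andP[] := iterlog_itv n.+1 t01.
Qed.

Lemma is_derive_X1 t : 0 < t < 1 -> is_derive t 1 X1 (X1 t ^+ 2 / t).
Proof.
move=> /[dup] t01 /andP[t0 t1]; have l := ln_lt0 t01.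
have dl := is_derive1_ln t0.
have d1 : is_derive t 1 (fun x => 1 - ln x) (- t^-1).
  by apply: (is_derive_eq (is_derive_funD (is_derive_const 1 t) (is_derive_funN dl))); rewrite add0r.
have nz : 1 - ln t != 0 by rewrite gt_eqF//; lra.
have := is_derive_funV d1 nz; rewrite opprK => H.
by apply: (is_derive_eq H); rewrite /X1 exprVn mulrC.
Qed.

Lemma is_derive_iterlog n t : 0 < t < 1 ->
  is_derive t 1 (iterlog n.+1) (logprod n t * iterlog n.+1 t ^+ 2 / t).
Proof.
move=> t01; elim: n => [|n IH].
  by rewrite logprod0 mul1r; exact: is_derive_X1.
have It := iterlog_itv n.+1 t01.
apply: (is_derive_eq (is_derive1_comp (is_derive_X1 It) IH)).
rewrite logprodS -[X1 (iterlog n.+1 t)]/(iterlog n.+2 t).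
by move: It t01 => /andP[I0 _] /andP[t0 _]; field; rewrite !gt_eqF.
Qed.

Lemma is_derive_logprod n t : 0 < t < 1 ->
  is_derive t 1 (logprod n) (logprod n t * logsum n t / t).
Proof.
move=> t01; elim: n => [|n IH].
  rewrite logsum0 mulr0 mul0r (_ : logprod 0 = fun=> 1); first exact: is_derive_const.
  by apply/funext => s; rewrite logprod0.
rewrite (_ : logprod n.+1 = fun s => logprod n s * iterlog n.+1 s); last first.
  by apply/funext => s; rewrite logprodS.
apply: (is_derive_eq (is_derive_funM IH (is_derive_iterlog n t01))).
by rewrite logsumS logprodS; ring.
Qed.

(** The derivative of B is the sum over i of P_i (P_1 + ... + P_i) / t, where
P_i = [logprod i]; each product of two distinct P's occurs once in it. *)
Lemma is_derive_logsum n t : 0 < t < 1 ->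
  is_derive t 1 (logsum n) ((logsum n t ^+ 2 + logsum2 n t) / (2 * t)).
Proof.
move=> t01; have t0 : t != 0 by case/andP: t01 => t0 _; rewrite gt_eqF.
elim: n => [|n IH].
  rewrite logsum0 logsum20 expr0n addr0 mul0r (_ : logsum 0 = fun=> 0); first exact: is_derive_const.
  by apply/funext => s; rewrite logsum0.
rewrite (_ : logsum n.+1 = fun s => logsum n s + logprod n.+1 s); last first.
  by apply/funext => s; rewrite logsumS.
apply: (is_derive_eq (is_derive_funD IH (is_derive_logprod n.+1 t01))).
by rewrite !logsumS !logsum2S; field.
Qed.

Lemma is_derive_logsum2 n t : 0 < t < 1 ->
  is_derive t 1 (logsum2 n) (2 * logsum3 n t / t).
Proof.
move=> t01; elim: n => [|n IH].
  rewrite logsum30 mulr0 mul0r (_ : logsum2 0 = fun=> 0); first exact: is_derive_const.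
  by apply/funext => s; rewrite logsum20.
rewrite (_ : logsum2 n.+1 = fun s => logsum2 n s + logprod n.+1 s * logprod n.+1 s); last first.
  by apply/funext => s; rewrite logsum2S expr2.
have dp := is_derive_logprod n.+1 t01.
apply: (is_derive_eq (is_derive_funD IH (is_derive_funM dp dp))).
by rewrite logsum3S; ring.
Qed.

Lemma logsum3_cont n t : 0 < t < 1 -> {for t, continuous (logsum3 n)}.
Proof.
move=> t01; elim: n => [|n IH].
  rewrite (_ : logsum3 0 = fun=> 0); last by apply/funext => s; rewrite logsum30.
  exact: cst_continuous.
rewrite (_ : logsum3 n.+1 = fun s => logsum3 n s + logprod n.+1 s * logprod n.+1 s * logsum n.+1 s);
  last by apply/funext => s; rewrite logsum3S expr2.
have cp := is_derive_continuous (is_derive_logprod n.+1 t01).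
have cs := is_derive_continuous (is_derive_logsum n.+1 t01).
exact: (continuous_at_funD IH (continuous_at_funM (continuous_at_funM cp cp) cs)).
Qed.

Lemma logprod_shift n t : logprod n.+1 t = X1 t * logprod n (X1 t).
Proof.
rewrite /logprod big_nat_recl//=; congr (_ * _).
by rewrite big_nat [RHS]big_nat; apply: eq_bigr => j _; rewrite /iterlog -iterSr.
Qed.

Lemma logsum_shift n t : logsum n.+1 t = X1 t * (1 + logsum n (X1 t)).
Proof.
elim: n => [|n IH]; first by rewrite logsumS logprod_shift !logsum0 logprod0; ring.
by rewrite logsumS IH logprod_shift [in RHS]logsumS; ring.
Qed.

Lemma logsum_ge0 n t : 0 < t < 1 -> 0 <= logsum n t.
Proof. by move=> t01; apply: sumr_ge0 => i _; rewrite ltW ?logprod_gt0. Qed.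

(** With y = - ln t, so that X_1(t) = 1 / (1 + y), the claim reads
(1 - e^-y) (4 + 5 y) <= 4 y (1 + y).  For y <= 2 it follows from
e^-y = (e^(-y/2))^2 >= (1 - y/2)^2, for larger y from 1 - e^-y <= 1. *)
Lemma logsum_supersolution t : 0 < t < 1 ->
  X1 t * (1 + 4 / (1 - X1 t)) <= 4 / (1 - t).
Proof.
move=> /[dup] t01 /andP[t0 t1]; have l := ln_lt0 t01.
set y := - ln t; have y0 : 0 < y by rewrite oppr_gt0.
have -> : X1 t = (1 + y)^-1 by [].
have -> : (1 + y)^-1 * (1 + 4 / (1 - (1 + y)^-1)) = (5 * y + 4) / (y * (1 + y)).
  by field; lra.
rewrite ler_pdivrMr ?mulr_gt0//; last by lra.
rewrite mulrAC ler_pdivlMr; last by lra.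
have tE : t = expR (- y) by rewrite opprK lnK.
have [y2|y2] := leP y 2; last by nra.
have h : 1 - y / 2 <= expR (- y / 2) by rewrite (le_trans _ (expR_ge1Dx _))//; lra.
have tE2 : t = expR (- y / 2) * expR (- y / 2) by rewrite -expRD tE; congr expR; field.
have : (1 - y / 2) * (1 - y / 2) <= t by rewrite tE2; apply: ler_pM => //; lra.
by nra.
Qed.

(** [logsum_shift] expresses B_(n+1) through B_n at X_1(t), so a supersolution of
this recursion dominates every B_n. *)
Lemma logsum_bound n t : 0 < t < 1 -> logsum n t <= 4 / (1 - t).
Proof.
elim: n t => [|n IH] t t01.
  by rewrite logsum0 divr_ge0//; lra.
have xI := X1_itv t01.
rewrite logsum_shift (le_trans _ (logsum_supersolution t01))//.
by rewrite ler_wpM2l ?lerD2l ?IH//; lra.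
Qed.

(** The point where X_1 equals e^-49; then X_1 and X_2 are at most 1/50. *)
Definition small_t : R := expR (1 - expR 49).

(** Two steps of the recursion give B <= X_1 (1 + X_2 (1 + 4 / (1 - X_2))), where
1 + 4 / (1 - X_2) <= 6 and 6/50 <= 1/8. *)
Lemma small_tP n t : 0 < t <= small_t ->
  [/\ t < 1, 0 < X1 t <= 1 / 50 & logsum n t <= 9 / 8 * X1 t].
Proof.
move=> /andP[t0 tt]; have e49 := expR_ge1Dx (49 : R).
have t1 : t < 1 by rewrite (le_lt_trans tt)// /small_t -[ltRHS]expR0 ltr_expR; lra.
have t01 : 0 < t < 1 by rewrite t0.
have /andP[x0 x1] := X1_itv t01.
have xe : X1 t <= expR (- 49).
  rewrite /X1 expRN lef_pV2 ?posrE ?expR_gt0//; last by have := ln_lt0 t01; lra.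
  have : ln t <= 1 - expR 49 by rewrite -(expRK (1 - expR 49)) ler_ln ?posrE ?expR_gt0.
  by lra.
have le50 (z : R) : 50 <= z -> z^-1 <= 1 / 50.
  by move=> z50; rewrite div1r lef_pV2 ?posrE//; lra.
have x50 : X1 t <= 1 / 50 by rewrite (le_trans xe)// expRN le50//; lra.
split=> //; first by rewrite x0.
have xI : 0 < X1 t < 1 by rewrite x0.
have /andP[y0 y1] := X1_itv xI.
have y50 : X1 (X1 t) <= 1 / 50.
  rewrite {1}/X1 le50//.
  have : ln (X1 t) <= - 49 by rewrite -(expRK (- 49)) ler_ln ?posrE ?expR_gt0.
  by lra.
case: n => [|[|n]]; first by rewrite logsum0; lra.
  by rewrite logsum_shift logsum0; lra.
rewrite logsum_shift logsum_shift.
have yI : 0 < X1 (X1 t) < 1 by rewrite y0.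
have B := logsum_bound n yI.
have B5 : logsum n (X1 (X1 t)) <= 5.
  apply: (le_trans B); rewrite ler_pdivrMr; lra.
have B0 := logsum_ge0 n yI.
have : X1 (X1 t) * (1 + logsum n (X1 (X1 t))) <= 1 / 50 * 6.
  by apply: ler_pM; [exact: ltW|lra|exact: y50|lra].
by move=> H; rewrite mulrC ler_wpM2r//; lra.
Qed.

Lemma logsum3_ge n t : 0 < t < 1 -> X1 t * logsum2 n t <= logsum3 n t.
Proof.
move=> t01; rewrite /logsum2 /logsum3 mulr_sumr.
rewrite big_nat [leRHS]big_nat; apply: ler_sum => -[//|i] _.
rewrite mulrC ler_wpM2l ?sqr_ge0// logsum_shift.
have xI := X1_itv t01.
by rewrite ler_peMr ?lerDl ?logsum_ge0//; lra.
Qed.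

Lemma logprod_le1 n t : 0 < t < 1 -> logprod n t <= 1.
Proof.
move=> t01; elim: n => [|n IH]; first by rewrite logprod0.
have /andP[i0 i1] := iterlog_itv n.+1 t01.
by rewrite logprodS mulr_ile1 ?(ltW (logprod_gt0 n t01))// ltW.
Qed.

Lemma logsum2_le n t : 0 < t < 1 -> logsum2 n t <= X1 t * logsum n t.
Proof.
move=> t01; rewrite /logsum2 /logsum mulr_sumr.
rewrite big_nat [leRHS]big_nat; apply: ler_sum => -[//|i] _.
rewrite expr2 ler_wpM2r ?(ltW (logprod_gt0 _ t01))//.
rewrite logprod_shift; have xI := X1_itv t01.
by rewrite ler_piMr ?logprod_le1//; lra.
Qed.

(** * The pairs (g, w) for the two inequalities *)

Section weights.
Variables (D : R) (n : nat).
Hypothesis D0 : 0 < D.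

Let b s := logsum n (s / D).
Let a s := logsum2 n (s / D).
Let c s := logsum3 n (s / D).

(** The functions of the introduction; [hardy_dg] and [rellich_dg] are the
derivatives of [hardy_g] and [rellich_g], and [hardy_w] is the weight that
the Hardy inequality yields and the Rellich inequality starts from. *)
Definition hardy_g s := (1 - b s) * (2 * s)^-1.
Definition hardy_dg s :=
  - (b s ^+ 2 + a s) * (2 * s)^-1 * (2 * s)^-1 - 2 * (1 - b s) * ((2 * s)^-1 * (2 * s)^-1).
Definition hardy_w s := (1 + a s) * (s^-1 * s^-1) * 4^-1.
Definition rellich_g s := (s^-1 * s^-1 * s^-1) * (1 + a s) * (3 / 8 - 8^-1 * b s - a s).
Definition rellich_dg s :=
  - 3 * (s^-1 * s^-1 * s^-1 * s^-1) * (1 + a s) * (3 / 8 - 8^-1 * b s - a s)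
  + (s^-1 * s^-1 * s^-1 * s^-1) * (2 * c s) * (3 / 8 - 8^-1 * b s - a s)
  - (s^-1 * s^-1 * s^-1 * s^-1) * (1 + a s) * ((b s ^+ 2 + a s) / 16 + 2 * c s).

Variable s : R.
Hypothesis sD : 0 < s <= D * small_t.

Let tP : 0 < s / D <= small_t.
Proof.
by move: sD => /andP[s0 sD']; rewrite divr_gt0//= ler_pdivrMr// mulrC.
Qed.

Let s0 : 0 < s. Proof. by case/andP: sD. Qed.

Let t01 : 0 < s / D < 1.
Proof. by have [-> _ _] := small_tP n tP; case/andP: tP => ->. Qed.

Let dscale : is_derive s 1 (fun x : R => x / D) D^-1.
Proof.
apply: (is_derive_eq (is_derive_funM (is_derive_var s) (is_derive_const D^-1 s))).
by rewrite mul1r mulr0 addr0.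
Qed.

Let db : is_derive s 1 b ((b s ^+ 2 + a s) * (2 * s)^-1).
Proof.
have H := @is_derive_fun_comp (logsum n) (fun x => x / D) s _ _ (is_derive_logsum n t01) dscale; apply: (is_derive_eq H).
by rewrite -/(b s) -/(a s); field; rewrite !gt_eqF.
Qed.

Let da : is_derive s 1 a (2 * c s * s^-1).
Proof.
have H := @is_derive_fun_comp (logsum2 n) (fun x => x / D) s _ _ (is_derive_logsum2 n t01) dscale; apply: (is_derive_eq H).
by rewrite -/(c s); field; rewrite !gt_eqF.
Qed.

Let cont_c : {for s, continuous c}.
Proof. by apply: continuous_comp; [exact: (is_derive_continuous dscale)|exact: logsum3_cont]. Qed.

Let dV : is_derive s 1 (fun x : R => x^-1) (- (s^-1 * s^-1)).
Proof.
have sN : (fun x : R => x) s != 0 by rewrite gt_eqF.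
apply: (is_derive_eq (is_derive_funV (is_derive_var s) sN)).
by rewrite mulNr div1r expr2 invfM.
Qed.

Let d2V : is_derive s 1 (fun x : R => (2 * x)^-1) (- 2 * ((2 * s)^-1 * (2 * s)^-1)).
Proof.
have sN : (fun x : R => 2 * x) s != 0 by rewrite mulf_neq0// gt_eqF.
apply: (is_derive_eq (is_derive_funV (is_derive_funM (is_derive_const 2 s) (is_derive_var s)) sN)).
by field; rewrite gt_eqF.
Qed.

Lemma is_derive_hardy_g : is_derive s 1 hardy_g (hardy_dg s).
Proof.
apply: (is_derive_eq (is_derive_funM (is_derive_funD (is_derive_const 1 s) (is_derive_funN db)) d2V)).
by rewrite /hardy_dg /=; ring.
Qed.

Lemma is_derive_rellich_g : is_derive s 1 rellich_g (rellich_dg s).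
Proof.
have dgamma := is_derive_funD (is_derive_funD (is_derive_const (3 / 8) s) (is_derive_funN (is_derive_funM (is_derive_const 8^-1 s) db)))
  (is_derive_funN da).
apply: (is_derive_eq (is_derive_funM (is_derive_funM (is_derive_funM (is_derive_funM dV dV) dV) (is_derive_funD (is_derive_const 1 s) da)) dgamma)).
by rewrite /rellich_dg /=; field; rewrite gt_eqF.
Qed.

Let cV := is_derive_continuous dV.
Let c2V := is_derive_continuous d2V.
Let ca := is_derive_continuous da.
Let cb := is_derive_continuous db.
Lemma hardy_dg_cont : {for s, continuous hardy_dg}.
Proof.
exact: (continuous_at_funD (continuous_at_funM (continuous_at_funM (continuous_at_funN (continuous_at_funD (continuous_at_funX2 cb) ca)) c2V) c2V)
  (continuous_at_funN (continuous_at_funM (continuous_at_funM (continuous_at_const 2 s) (continuous_at_funD (continuous_at_const 1 s) (continuous_at_funN cb))) (continuous_at_funM c2V c2V)))).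
Qed.

Lemma hardy_w_cont : {for s, continuous hardy_w}.
Proof. exact: (continuous_at_funM (continuous_at_funM (continuous_at_funD (continuous_at_const 1 s) ca) (continuous_at_funM cV cV)) (continuous_at_const 4^-1 s)). Qed.

Lemma rellich_dg_cont : {for s, continuous rellich_dg}.
Proof.
have c4 := continuous_at_funM (continuous_at_funM (continuous_at_funM cV cV) cV) cV.
have c1 := continuous_at_funD (continuous_at_const 1 s) ca.
have cg := continuous_at_funD (continuous_at_funD (continuous_at_const (3 / 8) s) (continuous_at_funN (continuous_at_funM (continuous_at_const 8^-1 s) cb))) (continuous_at_funN ca).
have Cc := continuous_at_funM (continuous_at_const 2 s) cont_c.
have cq := continuous_at_funD (continuous_at_funM (continuous_at_funD (continuous_at_funX2 cb) ca) (continuous_at_const 16^-1 s)) Cc.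
exact: (continuous_at_funD (continuous_at_funD (continuous_at_funM (continuous_at_funM (continuous_at_funM (continuous_at_const (- 3) s) c4) c1) cg) (continuous_at_funM (continuous_at_funM c4 Cc) cg))
  (continuous_at_funN (continuous_at_funM (continuous_at_funM c4 c1) cq))).
Qed.

Lemma logprod_scale_cont : {for s, continuous (fun x : R => logprod n (x / D))}.
Proof. exact: (continuous_comp (is_derive_continuous dscale) (is_derive_continuous (is_derive_logprod n t01))). Qed.

Let a0 : 0 <= a s. Proof. by apply: sumr_ge0 => i _; rewrite sqr_ge0. Qed.

Let b0 : 0 <= b s. Proof. exact: logsum_ge0. Qed.

Let small : exists p, [/\ 0 < p <= 1 / 50, b s <= 9 / 8 * p, a s <= p * b s &
  p * a s <= c s].
Proof.
have [_ p50 bp] := small_tP n tP; exists (X1 (s / D)); split => //.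
  exact: logsum2_le.
exact: logsum3_ge.
Qed.

Lemma hardy_g_ge0 : 0 <= hardy_g s.
Proof.
have [p [/andP[p0 p50] bp _ _]] := small.
by rewrite /hardy_g mulr_ge0 ?invr_ge0 ?mulr_ge0// ?(ltW s0)//; lra.
Qed.

Lemma hardy_w_gt0 : 0 < hardy_w s.
Proof. by rewrite /hardy_w !mulr_gt0 ?invr_gt0//; have := a0; lra. Qed.

Lemma hardy_riccati : - hardy_dg s - hardy_g s ^+ 2 / 1 = hardy_w s.
Proof. by rewrite /hardy_dg /hardy_g /hardy_w; field; rewrite gt_eqF. Qed.

Let a_small : a s <= 1 / 100.
Proof. by have [p [/andP[p0 p50] bp ab _]] := small; nra. Qed.

Lemma rellich_g_ge0 : 0 <= rellich_g s.
Proof.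
have [p [/andP[p0 p50] bp ab _]] := small; have := a_small => as_.
by rewrite /rellich_g !mulr_ge0 ?invr_ge0 ?(ltW s0)//; have := a0; lra.
Qed.

(** The terms of order at most two cancel; of the rest, only
5/4 [logsum3] is needed against (1 + S) (B S + 4 S^2), by means of
X_1 S <= [logsum3], S <= X_1 B and B <= 9/8 X_1 <= 9/400. *)
Lemma rellich_riccati :
  (9 / 16 + 5 / 8 * a s) / s ^+ 4 <= - rellich_dg s - rellich_g s ^+ 2 / hardy_w s.
Proof.
have [p [/andP[p0 p50] bp ab pc]] := small; have as_ := a_small.
rewrite -subr_ge0.
have -> : - rellich_dg s - rellich_g s ^+ 2 / hardy_w s - (9 / 16 + 5 / 8 * a s) / s ^+ 4 =
  ((1 + a s) * (2 * c s - b s * a s - 4 * a s ^+ 2) + 2 * a s * c s + a s ^+ 2 / 16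
    - (3 / 4 - b s / 4) * c s) / s ^+ 4.
  rewrite /rellich_dg /rellich_g /hardy_w; field; rewrite gt_eqF//=.
  by have := a0; lra.
move: (a s) (b s) (c s) a0 b0 bp ab pc as_ => A B C A0 B0 bp ab pc as_.
apply: divr_ge0; last by rewrite exprn_ge0// ltW.
have C0 : 0 <= C by apply: le_trans pc; apply: mulr_ge0 => //; exact: ltW.
have h1 : B * A + 4 * A ^+ 2 <= 49 / 40 * (p * A).
  have pA0 : 0 <= p * A by exact: mulr_ge0 (ltW p0) A0.
  have : 4 * A * A <= 4 * A * (p * (9 / 400)) by apply: ler_wpM2l; nra.
  have : B * A <= 9 / 8 * p * A by exact: ler_wpM2r.
  by rewrite expr2; lra.
have h2 : (1 + A) * (B * A + 4 * A ^+ 2) <= (1 + 1 / 100) * (49 / 40 * C).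
  have h1' : B * A + 4 * A ^+ 2 <= 49 / 40 * C.
    by apply: (le_trans h1); apply: ler_wpM2l pc; lra.
  apply: ler_pM; [exact: addr_ge0| |by rewrite lerD2l|exact: h1'].
  by apply: addr_ge0; rewrite mulr_ge0 ?sqr_ge0.
have h3 : 0 <= A * C by exact: mulr_ge0.
have h4 : 0 <= B * C by exact: mulr_ge0.
have h5 : 0 <= A ^+ 2 by exact: sqr_ge0.
have -> : (1 + A) * (2 * C - B * A - 4 * A ^+ 2) + 2 * A * C + A ^+ 2 / 16
    - (3 / 4 - B / 4) * C =
    5 / 4 * C + 4 * (A * C) + B * C / 4 + A ^+ 2 / 16 - (1 + A) * (B * A + 4 * A ^+ 2).
  by field.
move: h2; set X := (1 + A) * (B * A + _) => h2.
clearbody X; lra.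
Qed.

End weights.
End iterated_logarithms.

(** * The Euclidean norm *)

Section euclidean_norm.
Context {R : realType} {N : nat}.
Implicit Types (x y z : 'rV[R]_N) (i : 'I_N).
Local Notation e i := (delta_mx ord0 i : 'rV[R]_N).

Definition dotp x y : R := \sum_i x ord0 i * y ord0 i.

Lemma dotpC x y : dotp x y = dotp y x.
Proof. by apply: eq_bigr => i _; rewrite mulrC. Qed.

Lemma dotpDl x y z : dotp (x + y) z = dotp x z + dotp y z.
Proof. by rewrite /dotp -big_split; apply: eq_bigr => i _; rewrite mxE mulrDl. Qed.

Lemma dotpZl a x z : dotp (a *: x) z = a * dotp x z.
Proof. by rewrite /dotp mulr_sumr; apply: eq_bigr => i _; rewrite mxE mulrA. Qed.

Lemma dotpNl x z : dotp (- x) z = - dotp x z.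
Proof. by rewrite -scaleN1r dotpZl mulN1r. Qed.

Lemma dotpDr x y z : dotp z (x + y) = dotp z x + dotp z y.
Proof. by rewrite !(dotpC z) dotpDl. Qed.

Lemma dotpZr a x z : dotp z (a *: x) = a * dotp z x.
Proof. by rewrite !(dotpC z) dotpZl. Qed.

Lemma dotpNr x z : dotp z (- x) = - dotp z x.
Proof. by rewrite !(dotpC z) dotpNl. Qed.

Definition dotpE := (dotpDl, dotpDr, dotpZl, dotpZr, dotpNl, dotpNr).

Lemma dotp_ge0 x : 0 <= dotp x x.
Proof. by apply: sumr_ge0 => i _; rewrite -expr2 sqr_ge0. Qed.

Lemma dotp_delta x i : dotp (e i) x = x ord0 i.
Proof.
rewrite /dotp (bigD1 i)//= mxE !eqxx mul1r big1 ?addr0// => j ji.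
by rewrite mxE (negbTE ji) andbF mul0r.
Qed.

Lemma enormE x : enorm x = Num.sqrt (dotp x x).
Proof. by congr Num.sqrt; apply: eq_bigr => i _; rewrite expr2. Qed.

Lemma enorm_ge0 x : 0 <= enorm x. Proof. exact: sqrtr_ge0. Qed.

Lemma enorm_sqr x : enorm x ^+ 2 = dotp x x.
Proof. by rewrite enormE sqr_sqrtr ?dotp_ge0. Qed.

Lemma enormZ a x : enorm (a *: x) = `|a| * enorm x.
Proof.
by rewrite !enormE !dotpE mulrA -expr2 sqrtrM ?sqr_ge0// sqrtr_sqr.
Qed.

Lemma enormN x : enorm (- x) = enorm x.
Proof. by rewrite -scaleN1r enormZ normrN normr1 mul1r. Qed.

Lemma enormB x y : enorm (x - y) = enorm (y - x).
Proof. by rewrite -enormN opprB. Qed.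

Lemma enorm_delta i : enorm (e i) = 1.
Proof. by rewrite enormE dotp_delta mxE !eqxx sqrtr1. Qed.

Lemma enorm_eq0 x : (enorm x == 0) = (x == 0).
Proof.
apply/eqP/eqP => [x0|->]; last first.
  by rewrite enormE /dotp big1 ?sqrtr0// => i _; rewrite mxE mul0r.
have := enorm_sqr x; rewrite x0 expr0n /= => /esym/eqP.
rewrite psumr_eq0 => [/allP H|i _]; last by rewrite -expr2 sqr_ge0.
apply/rowP => i; rewrite mxE; apply/eqP.
by have := H i (mem_index_enum i); rewrite /= mulf_eq0 orbb.
Qed.

Lemma cauchy_schwarz x y : dotp x y <= enorm x * enorm y.
Proof.
have [->|y0] := eqVneq y 0.
  by rewrite (_ : dotp x 0 = 0) ?mulr_ge0 ?enorm_ge0//; apply: big1 => i _; rewrite mxE mulr0.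
have Y0 : 0 < enorm y by rewrite lt_neqAle enorm_ge0 eq_sym enorm_eq0 y0.
have [->|x0] := eqVneq x 0.
  by rewrite (_ : dotp 0 y = 0) ?mulr_ge0 ?enorm_ge0//; apply: big1 => i _; rewrite mxE mul0r.
have X0 : 0 < enorm x by rewrite lt_neqAle enorm_ge0 eq_sym enorm_eq0 x0.
have := dotp_ge0 (enorm y *: x - enorm x *: y).
have -> : dotp (enorm y *: x - enorm x *: y) (enorm y *: x - enorm x *: y)
   = 2 * (enorm x * enorm y) * (enorm x * enorm y - dotp x y).
  by rewrite !dotpE -!enorm_sqr (dotpC y x); ring.
by rewrite pmulr_rge0 ?subr_ge0// mulr_gt0// mulr_gt0.
Qed.

Lemma enorm_triangle x y : enorm (x + y) <= enorm x + enorm y.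
Proof.
rewrite -(@ler_sqr _ (enorm (x + y))) ?nnegrE ?addr_ge0 ?enorm_ge0//.
rewrite enorm_sqr !dotpE sqrrD -!enorm_sqr (dotpC y x).
by have := cauchy_schwarz x y; rewrite mulr2n; lra.
Qed.

Lemma coord_le_enorm x i : `|x ord0 i| <= enorm x.
Proof.
rewrite -(@ler_sqr _ `|_|) ?nnegrE ?enorm_ge0// real_normK ?num_real//.
rewrite enorm_sqr /dotp (bigD1 i)//= -expr2 lerDl.
by apply: sumr_ge0 => j _; rewrite -expr2 sqr_ge0.
Qed.

Lemma norm_le_enorm x : `|x| <= enorm x.
Proof. by apply: norm_le_coord; [exact: enorm_ge0|exact: coord_le_enorm]. Qed.

Lemma enorm_le_norm x : enorm x <= (N%:R + 1) * `|x|.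
Proof.
have N1 : 0 <= N%:R + 1 :> R by rewrite addr_ge0.
rewrite -(@ler_sqr _ (enorm x)) ?nnegrE ?enorm_ge0 ?mulr_ge0//.
rewrite enorm_sqr; apply: (@le_trans _ _ (\sum_(i < N) `|x| ^+ 2)).
  apply: ler_sum => i _; rewrite -expr2 -[leLHS]real_normK ?num_real//.
  by rewrite ler_sqr ?nnegrE// coord_le_norm.
rewrite sumr_const card_ord exprMn -[leLHS]mulr_natl ler_wpM2r ?sqr_ge0//.
by have : 0 <= N%:R :> R by []; nra.
Qed.

End euclidean_norm.

(** * The distance to the boundary of a convex open set *)

Section distance_to_boundary.
Context {R : realType} {N : nat}.
Implicit Types (x y z p : 'rV[R]_N) (i : 'I_N).
Local Notation e i := (delta_mx ord0 i : 'rV[R]_N).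
Variable Omega : set 'rV[R]_N.
Hypothesis oO : open Omega.
Hypothesis cO : forall x y (t : R), Omega x -> Omega y -> 0 <= t <= 1 ->
  Omega (t *: x + (1 - t) *: y).
Hypothesis bO : boundary Omega !=set0.
Local Notation d := (dist_boundary Omega).

Lemma near_norm_le x (r : R) : 0 < r -> \forall y \near x, `|x - y| <= r.
Proof. by move=> r0; apply/nbhs_normP; exists r => //= y /ltW. Qed.

Lemma near_enorm_le x (r : R) : 0 < r -> \forall y \near x, enorm (x - y) <= r.
Proof.
move=> r0; have N1 : 0 < N%:R + 1 :> R by rewrite ltr_wpDl.
apply: filterS (near_norm_le x (divr_gt0 r0 N1)) => y xy.
by apply: (le_trans (enorm_le_norm _)); rewrite mulrC -ler_pdivlMr.
Qed.

Lemma enorm_continuous : continuous (@enorm R N).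
Proof.
move=> x; apply/(@cvgrPdist_le _ _ _ (nbhs x)) => /= eps eps0.
apply: filterS (near_enorm_le x eps0) => y H3.
have H1 := enorm_triangle (x - y) y; have H2 := enorm_triangle (y - x) x.
rewrite !subrK in H1 H2; rewrite enormB in H2.
by rewrite ler_norml; lra.
Qed.

Lemma boundary_nOmega y : boundary Omega y -> ~ Omega y.
Proof. by case=> _; rewrite ((interior_id _).1 oO). Qed.

Lemma boundary_closed : closed (boundary Omega).
Proof.
rewrite /boundary setDE; apply: closedI; first exact: closed_closure.
by apply: open_closedC; exact: open_interior.
Qed.

Lemma nearest_boundary x : exists y, [/\ boundary Omega y, d x = enorm (x - y),
  edist_boundary Omega x = (enorm (x - y))%:E &
  forall z, boundary Omega z -> enorm (x - y) <= enorm (x - z)].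
Proof.
have [y0 By0] := bO.
pose f z := enorm (x - z).
have cf : continuous f.
  move=> z; apply: (@continuous_comp _ _ _ (fun z => x - z) (@enorm R N)); last exact: enorm_continuous.
  by apply: continuousB; [exact: cst_continuous|exact: cvg_id].
pose K := boundary Omega `&` [set z | f z <= f y0].
have cK : compact K.
  apply: bounded_closed_compact.
    exists (`|x| + f y0); split; first exact: num_real.
    move=> M HM z [_ /= fz]; apply: le_trans (ltW HM).
    rewrite -[z](subKr x) (le_trans (ler_normB _ _))// lerD2l.
    by rewrite (le_trans (norm_le_enorm _)).
  apply: closedI; first exact: boundary_closed.
  apply: (@preimage_closed _ _ f [set r | r <= f y0]); last exact: closed_le.
  by move=> z _; exact: cf.
have K0 : K !=set0 by exists y0; split => //=.
have [y yK Hy] := EVT_min_rV K0 cK (continuous_subspaceT cf).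
rewrite inE in yK; have [By fy] := yK.
have min z : boundary Omega z -> f y <= f z.
  move=> Bz; have [zy0|/ltW zy0] := leP (f z) (f y0); last exact: le_trans fy zy0.
  by apply: Hy; rewrite inE.
have E : edist_boundary Omega x = (f y)%:E.
  apply/eqP; rewrite eq_le; apply/andP; split.
    by apply: ereal_inf_lbound; exists y.
  by apply: le_ereal_inf_tmp => _ [z Bz <-]; rewrite lee_fin; exact: min.
by exists y; split => //; rewrite /dist_boundary E.
Qed.

Lemma dist_le x z : boundary Omega z -> d x <= enorm (x - z).
Proof. by move=> Bz; have [y [_ -> _ min]] := nearest_boundary x; exact: min. Qed.

Lemma dist_lip x z : `|d x - d z| <= enorm (x - z).
Proof.
have key u v : d u <= enorm (u - v) + d v.
  have [y [By -> _ _]] := nearest_boundary v.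
  apply: (le_trans (dist_le u By)); apply: le_trans (enorm_triangle _ _).
  by rewrite addrA subrK.
have := key x z; have := key z x; rewrite (enormB z x) ler_norml; lra.
Qed.

Lemma dist_continuous : continuous d.
Proof.
move=> x; apply/(@cvgrPdist_le _ _ _ (nbhs x)) => /= eps eps0.
by apply: filterS (near_enorm_le x eps0) => y; exact: le_trans (dist_lip x y).
Qed.

Lemma dist_gt0 x : Omega x -> 0 < d x.
Proof.
move=> Ox; have [y [/boundary_nOmega By -> _ _]] := nearest_boundary x.
rewrite lt_neqAle enorm_ge0 andbT eq_sym enorm_eq0 subr_eq0.
by apply/eqP => xy; apply: By; rewrite -xy.
Qed.

(** A segment that leaves the open set meets its boundary, at the supremum of the
times up to which it is inside. *)
Lemma dist_le_outside z p : Omega z -> ~ Omega p -> d z <= enorm (z - p).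
Proof.
move=> Oz nOp.
pose l (t : R) : 'rV[R]_N := z + t *: (p - z).
have lc : continuous l.
  move=> t; apply: cvgD; first exact: cvg_cst.
  by apply: cvgZr_tmp; exact: cvg_id.
pose S := [set t : R | 0 <= t <= 1 /\ Omega (l t)].
have S0 : S 0 by split; rewrite ?lexx ?ler01// /l scale0r addr0.
have hS : has_sup S by split; [exists 0|exists 1 => t [/andP[_ ->]]].
have s0 : 0 <= sup S by exact: sup_upper_bound.
have s1 : sup S <= 1 by apply: sup_le_ub; [exists 0|move=> t [/andP[_ ->]]].
have nO : ~ Omega (l (sup S)).
  move=> Ol.
  have s1' : sup S < 1.
    rewrite lt_neqAle s1 andbT; apply/eqP => s1'; apply: nOp.
    by move: Ol; rewrite s1' /l scale1r addrC subrK.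
  have /nbhs_ballP[r /= r0 Hr] := lc _ _ (open_nbhs_nbhs (conj oO Ol)).
  pose t := Num.min (sup S + r / 2) 1.
  have st : sup S < t by rewrite lt_min s1' andbT ltrDl divr_gt0.
  have : S t.
    split; first by rewrite (le_trans s0 (ltW st)) ge_min lexx orbT.
    have tle : t <= sup S + r / 2 by rewrite /t ge_min lexx.
    by apply: Hr; rewrite /ball /= ltr0_norm ?subr_lt0// opprB; lra.
  by move=> /(sup_upper_bound hS); rewrite leNgt st.
have Bl : boundary Omega (l (sup S)).
  split; last by rewrite ((interior_id _).1 oO).
  move=> U /lc /nbhs_ballP[r /= r0 Hr].
  have [t [t01 Olt] tr] := sup_adherent r0 hS.
  exists (l t); split => //; apply: Hr; rewrite /ball /=.
  have ts : t <= sup S by apply: sup_upper_bound.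
  by rewrite ger0_norm ?subr_ge0//; lra.
apply: (le_trans (dist_le z Bl)).
rewrite /l opprD addrA subrr sub0r -scalerN opprB enormZ ger0_norm//.
by rewrite ler_piMl ?enorm_ge0.
Qed.

(** Let [y] be a boundary point nearest to [x].  If a point [z] of the set were
strictly on the wrong side of the hyperplane through [y] orthogonal to [x - y],
then beyond [y] on the line from [z] there would be points [w] closer to [x]
than [y], hence inside, and convexity would put [y] inside.  So the set lies in
a half-space, whose boundary is at least as far from each point as the boundary
of the set, with equality at [x]. *)
Lemma supporting_hyperplane x : Omega x -> exists2 nu, dotp nu nu = 1 &
  forall z, Omega z -> d z <= d x + dotp (z - x) nu.
Proof.
move=> Ox; have d0 := dist_gt0 Ox.
have [y [By dxy _ _]] := nearest_boundary x.
have nOy := boundary_nOmega By.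
have [nu nu1 dn] : exists2 nu, dotp nu nu = 1 & d x *: nu = x - y.
  exists ((d x)^-1 *: (x - y)); last by rewrite scalerA divff ?scale1r// gt_eqF.
  by rewrite dotpZl dotpZr -enorm_sqr -dxy; field; rewrite gt_eqF.
have half z : Omega z -> 0 <= dotp (z - y) nu.
  move=> Oz; rewrite leNgt; apply/negP => neg.
  pose beta := - (d x * dotp (z - y) nu).
  have beta0 : 0 < beta by rewrite /beta oppr_gt0 pmulr_rlt0.
  pose m := dotp (z - y) (z - y).
  have m0 : 0 <= m by exact: dotp_ge0.
  pose c := beta / (m + 1).
  have c0 : 0 < c by rewrite divr_gt0// ltr_wpDl.
  pose w := y + c *: (y - z).
  have xw : enorm (x - w) < d x.
    rewrite -(@ltr_sqr _ (enorm _)) ?nnegrE ?enorm_ge0 ?(ltW d0)// enorm_sqr.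
    have -> : x - w = d x *: nu + c *: (z - y).
      by rewrite dn /w opprD addrA -scalerN opprB.
    rewrite !dotpDl !dotpDr !dotpZl !dotpZr -/m nu1 (dotpC nu).
    have -> : d x * (d x * 1) + d x * (c * dotp (z - y) nu) +
      (c * (d x * dotp (z - y) nu) + c * (c * m)) = d x ^+ 2 - c * (2 * beta - c * m).
      by rewrite /beta; ring.
    rewrite ltrBlDr ltrDl mulr_gt0// subr_gt0.
    have : c * m <= beta.
      by rewrite /c mulrAC ler_pdivrMr ?ltr_wpDl// ler_wpM2l ?(ltW beta0)// lerDl.
    by lra.
  have Ow : Omega w.
    by apply: contrapT => nOw; have := dist_le_outside Ox nOw; rewrite leNgt xw.
  apply: nOy; have c1 : 1 + c != 0 by rewrite gt_eqF// addr_gt0.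
  have -> : y = (1 + c)^-1 *: w + (1 - (1 + c)^-1) *: z.
    apply/rowP => i; rewrite !mxE; field; exact: c1.
  by apply: cO => //; rewrite invr_ge0 invf_le1 ?addr_gt0//; lra.
exists nu => // z Oz.
pose s := dotp (z - y) nu.
have s0 : 0 <= s by exact: half.
have nOp : ~ Omega (z - s *: nu).
  move=> Op.
  have cl : {for 0, continuous (fun t : R => (z - s *: nu) - t *: nu)}.
    apply: cvgB; first exact: cvg_cst.
    by apply: cvgZr_tmp; exact: cvg_id.
  have /nbhs_ballP[r /= r0 Hr] : nbhs (0 : R) [set t | Omega ((z - s *: nu) - t *: nu)].
    by apply: cl; rewrite scale0r subr0; exact: open_nbhs_nbhs.
  have : Omega ((z - s *: nu) - (r / 2) *: nu).
    by apply: Hr; rewrite /ball /= sub0r normrN gtr0_norm; lra.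
  move=> /half; have -> : z - s *: nu - (r / 2) *: nu - y = (z - y) - (s + r / 2) *: nu.
    by apply/rowP => i; rewrite !mxE; ring.
  by rewrite dotpDl dotpNl dotpZl nu1 -/s; lra.
apply: (le_trans (dist_le_outside Oz nOp)).
rewrite subKr enormZ enormE nu1 sqrtr1 mulr1 ger0_norm//.
rewrite /s; have -> : z - y = (x - y) + (z - x) by apply/rowP => i; rewrite !mxE; ring.
by rewrite -dn dotpDl dotpZl nu1 mulr1.
Qed.

End distance_to_boundary.

(** * Truncating the distance away from the support *)

Section clipping.
Context {R : realType}.

Definition clip (k M r : R) := Num.min (Num.max r k) M.

Lemma clip_itv k M r : k <= M -> k <= clip k M r <= M.
Proof. by move=> kM; rewrite /clip le_min le_max lexx orbT kM ge_min lexx orbT. Qed.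

Lemma clip_id k M r : k <= r <= M -> clip k M r = r.
Proof. by move=> /andP[kr rM]; rewrite /clip (max_idPl kr) (min_idPl rM). Qed.

Lemma clip_lip k M r s : `|clip k M r - clip k M s| <= `|r - s|.
Proof.
rewrite ler_norml /clip; have := ler_norm (r - s); have := lerNnormlW (lexx `|r - s|).
by case: (leP (Num.max r k) M); case: (leP (Num.max s k) M);
  case: (leP r k) => ?; case: (leP s k) => ? ? ?; lra.
Qed.

End clipping.

Section clipped_distance.
Context {R : realType} {N : nat}.
Implicit Types (x : 'rV[R]_N) (i : 'I_N).
Local Notation e i := (delta_mx ord0 i : 'rV[R]_N).

(** [weighted_hardy] wants a function on the whole space with values in a compact
interval of positive numbers.  Truncation provides one that agrees with the
distance within a step of [K], the support of the test function. *)
Lemma clipped_distance (Omega K : set 'rV[R]_N) (M : R) :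
  open Omega ->
  (forall x y (t : R), Omega x -> Omega y -> 0 <= t <= 1 ->
    Omega (t *: x + (1 - t) *: y)) ->
  boundary Omega !=set0 -> 0 < M ->
  (forall x, Omega x -> dist_boundary Omega x <= M) ->
  compact K -> K `<=` Omega ->
  exists (rho : 'rV[R]_N -> R) (k : R), [/\ continuous rho,
    0 < k, forall x, k <= rho x <= M,
    forall x i h, `|rho (x + h *: e i) - rho x| <= `|h| &
    forall x, K x -> rho x = dist_boundary Omega x /\
      exists2 nu : 'I_N -> R, \sum_i nu i ^+ 2 = 1 &
      forall i t, `|t| <= k -> rho (x + t *: e i) <= rho x + t * nu i].
Proof.
move=> oO cO bO M0 dM cK KO.
pose d := dist_boundary Omega.
have [m m0 md] : exists2 m, 0 < m & forall x, K x -> m <= d x.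
  have [K0|nK] := pselect (K !=set0); last first.
    by exists 1 => // x Kx; exfalso; apply: nK; exists x.
  have [c cK' Hc] := EVT_min_rV K0 cK (continuous_subspaceT (dist_continuous bO)).
  rewrite inE in cK'; exists (d c); first by apply: dist_gt0 => //; exact: KO.
  by move=> x Kx; apply: Hc; rewrite inE.
pose k := Num.min m M / 2.
have mM0 : 0 < Num.min m M by rewrite lt_min m0.
have k0 : 0 < k by rewrite divr_gt0.
have km : k + k <= m by rewrite /k -splitr ge_min lexx.
have kM2 : k + k <= M by rewrite /k -splitr ge_min lexx orbT.
have kM : k <= M by lra.
pose rho x := clip k M (d x).
have rho_lip x y : `|rho x - rho y| <= enorm (x - y).
  exact: le_trans (clip_lip _ _ _ _) (dist_lip bO x y).
have step x i h : enorm (x + h *: e i - x) = `|h|.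
  by rewrite addrC addKr enormZ enorm_delta mulr1.
exists rho, k; split => //.
- move=> x; apply/(@cvgrPdist_le _ _ _ (nbhs x)) => /= eps eps0.
  by apply: filterS (near_enorm_le x eps0) => y; exact: le_trans (rho_lip x y).
- by move=> x; exact: clip_itv.
- by move=> x i h; rewrite -(step x i h).
move=> x Kx; have Ox := KO _ Kx; have mx := md _ Kx.
have rE : rho x = d x by apply: clip_id; rewrite dM// andbT; lra.
split=> //; have [nu nu1 nuP] := supporting_hyperplane oO cO bO Ox.
exists (nu ord0) => [|i t tk].
  by rewrite -[RHS]nu1; apply: eq_bigr => i _; rewrite expr2.
have dt : `|d (x + t *: e i) - d x| <= `|t| by rewrite -(step x i t); exact: dist_lip.
have Ot : Omega (x + t *: e i).
  apply: contrapT => /(dist_le_outside oO bO Ox); rewrite enormB step.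
  by rewrite -/(d x) leNgt => /negP; apply; lra.
have dk : k <= d (x + t *: e i).
  by move: dt; rewrite ler_norml => /andP[dt _]; lra.
rewrite rE /rho clip_id; last by rewrite dk dM.
by have := nuP _ Ot; rewrite [x + t *: e i]addrC addrK dotpZl dotp_delta.
Qed.

End clipped_distance.

(** * From integrals over the space to integrals over the domain *)

Section integrals_over_domain.
Context {R : realType} {N : nat}.
Local Notation mu := (lebesgue_rV N).

Lemma integral_domain (Omega : set 'rV[R]_N) (f : 'rV[R]_N -> R) (F : 'rV[R]_N -> \bar R) :
  measurable Omega -> Cc f -> (forall x, f x != 0 -> Omega x) ->
  (forall x, Omega x -> F x = (f x)%:E) ->
  (\int[mu]_(x in Omega) F x = (\int[mu]_x f x)%R%:E)%E.
Proof.
move=> mO cf fO FE.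
rewrite /Rintegral fineK; last exact: integrable_fin_num (Cc_integrable cf).
rewrite [LHS]integral_mkcond. apply: eq_integral => x _; rewrite patchE.
case: ifPn => [|nO]; first by rewrite inE => /FE.
have [-> //|/fO] := eqVneq (f x) 0.
by rewrite -inE (negbTE nO).
Qed.

Lemma series_bound (a b r J : R) (s : nat -> R) : 0 < b -> (forall i, 0 <= s i) ->
  (forall n, a * r + b * \sum_(1 <= i < n.+1) s i <= J) ->
  (a%:E * r%:E + b%:E * \sum_(1 <= i <oo) (s i)%:E <= J%:E)%E.
Proof.
move=> b0 s0 H.
have L : (\sum_(1 <= i <oo) (s i)%:E <= ((J - a * r) / b)%:E)%E.
  apply: lime_le; first by apply: is_cvg_nneseries => i _ _; rewrite lee_fin.
  apply: nearW => n; rewrite sumEFin lee_fin ler_pdivlMr// mulrC lerBrDl.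
  case: n => [|n]; last exact: H.
  by have := H 0%N; rewrite !big_geq.
apply: (@le_trans _ _ ((a * r)%:E + b%:E * ((J - a * r) / b)%:E)%E).
  by rewrite -EFinM; apply: leeD => //; apply: lee_wpmul2l => //; rewrite lee_fin ltW.
by rewrite -EFinM -EFinD lee_fin mulrCA divff ?mulr1 ?gt_eqF// addrC subrK.
Qed.

End integrals_over_domain.

(** * The inequalities for finitely many logarithmic terms *)

Section improved_inequalities.
Context {R : realType} {N : nat}.
Implicit Types (x : 'rV[R]_N) (i : 'I_N).
Local Notation e i := (delta_mx ord0 i : 'rV[R]_N).
Local Notation mu := (lebesgue_rV N).
Variables (rho : 'rV[R]_N -> R) (k M D : R) (K : set 'rV[R]_N).
Hypothesis crho : continuous rho.
Hypothesis k0 : 0 < k.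
Hypothesis rho_itv : forall x, k <= rho x <= M.
Hypothesis rho_lip : forall x i h, `|rho (x + h *: e i) - rho x| <= `|h|.
Hypothesis rho_sup : forall x, K x -> exists2 nu : 'I_N -> R,
  \sum_i nu i ^+ 2 = 1 &
  forall i t, `|t| <= k -> rho (x + t *: e i) <= rho x + t * nu i.
Hypothesis D0 : 0 < D.
Hypothesis MD : M <= D * small_t.

Let itv_small s : k <= s <= M -> 0 < s <= D * small_t.
Proof. by move=> /andP[ks sM]; rewrite (lt_le_trans k0 ks) (le_trans sM MD). Qed.

Lemma improved_hardy n v : Cc1 v -> (forall x, v x != 0 -> K x) ->
  (\int[mu]_x (hardy_w D n (rho x) * v x ^+ 2) <=
   \int[mu]_x (\sum_i partial i v x ^+ 2))%R.
Proof.
move=> cv vK.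
have H := @weighted_hardy R N v rho k M k cv crho rho_itv rho_lip k0
  (fun x vx => rho_sup (vK x vx)) (hardy_g D n) (hardy_dg D n) (fun=> 1)
  (fun s sI => is_derive_hardy_g n D0 (itv_small sI))
  (fun s sI => hardy_dg_cont D0 (itv_small sI))
  (fun s _ => @continuous_at_const R 1 s)
  (fun s sI => hardy_g_ge0 n D0 (itv_small sI))
  (fun s _ => ltr01).
rewrite (_ : (fun x => hardy_w D n (rho x) * v x ^+ 2) = fun x =>
  (- hardy_dg D n (rho x) - hardy_g D n (rho x) ^+ 2 / 1) * v x ^+ 2); last first.
  by apply/funext => x; rewrite (hardy_riccati n (itv_small (rho_itv x))).
apply: (le_trans H); rewrite le_eqVlt; apply/orP; left; apply/eqP.
by apply: eq_Rintegral => x _; rewrite mul1r.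
Qed.

Let cont_logsum2 n : continuous (fun x => logsum2 n (rho x / D)).
Proof.
elim: n => [|n IH].
  by under eq_fun do rewrite logsum20; exact: cst_continuous.
under eq_fun do rewrite logsum2S expr2.
apply: continuous_funD => //.
have c : continuous (fun x => logprod n.+1 (rho x / D)).
  exact: (continuous_itv_comp (F := fun s => logprod n.+1 (s / D))
    (fun s sI => logprod_scale_cont D0 (itv_small sI)) rho_itv crho).
exact: continuous_funM.
Qed.

Let cont_logprod2 (i : nat) : continuous (fun x => logprod i (rho x / D) ^+ 2).
Proof.
have c : continuous (fun x => logprod i (rho x / D)).
  exact: (continuous_itv_comp (F := fun s => logprod i (s / D))
    (fun s sI => logprod_scale_cont D0 (itv_small sI)) rho_itv crho).
exact: (continuous_funM c c).
Qed.

Let rho_gt0 x : 0 < rho x.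
Proof. by have /andP[+ _] := rho_itv x; exact: lt_le_trans. Qed.

Let cont_invX m : continuous (fun x => (rho x ^+ m)^-1).
Proof.
apply: (continuous_itv_comp (F := fun r => (r ^+ m)^-1) _ rho_itv crho) => s /andP[ks _].
apply: (@continuousV _ _ (fun r : R => r ^+ m)); last exact: exprn_continuous.
by rewrite expf_neq0// gt_eqF// (lt_le_trans k0).
Qed.

Lemma Cc_div_rho m f : Cc f -> Cc (fun x => f x / rho x ^+ m).
Proof. by move=> cf; apply: Cc_mulr. Qed.

Lemma Cc_logprod2 (i : nat) f : Cc f -> Cc (fun x => f x * logprod i (rho x / D) ^+ 2).
Proof. by move=> cf; apply: Cc_mulr. Qed.

Lemma int_logsum2 n (a b : R) f : Cc f ->
  (\int[mu]_x ((a + b * logsum2 n (rho x / D)) * f x) =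
   a * \int[mu]_x f x +
   b * \sum_(1 <= i < n.+1) \int[mu]_x (f x * logprod i (rho x / D) ^+ 2))%R.
Proof.
move=> cf; have cL (i : nat) := Cc_logprod2 i cf.
have cS : Cc (fun x => \sum_(1 <= i < n.+1) f x * logprod i (rho x / D) ^+ 2).
  by apply: Cc_sum => i _; exact: cL.
rewrite -Cc_int_sum; last by move=> i _; exact: cL.
rewrite -!Cc_intZ// -Cc_intD; [|exact: CcZ|exact: CcZ].
apply: eq_Rintegral => x _.
by rewrite -mulr_sumr -/(logsum2 n (rho x / D)); ring.
Qed.

Lemma improved_rellich n u : Cc1 u -> (forall x, u x != 0 -> K x) ->
  (\int[mu]_x ((9 / 16 + 5 / 8 * logsum2 n (rho x / D)) * (u x ^+ 2 / rho x ^+ 4)) <=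
   \int[mu]_x (hardy_w D n (rho x) * (\sum_i partial i u x ^+ 2)))%R.
Proof.
move=> cu uK.
have H := @weighted_hardy R N u rho k M k cu crho rho_itv rho_lip k0
  (fun x ux => rho_sup (uK x ux)) (rellich_g D n) (rellich_dg D n) (hardy_w D n)
  (fun s sI => is_derive_rellich_g n D0 (itv_small sI))
  (fun s sI => rellich_dg_cont D0 (itv_small sI))
  (fun s sI => hardy_w_cont D0 (itv_small sI))
  (fun s sI => rellich_g_ge0 n D0 (itv_small sI))
  (fun s sI => hardy_w_gt0 n (itv_small sI)).
apply: le_trans H.
have cu2 : Cc (fun x => u x ^+ 2) by exact: (Cc_mulr (Cc1_Cc cu) (Cc1_Cc cu).1).
have c1 : continuous (fun x => 9 / 16 + 5 / 8 * logsum2 n (rho x / D)).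
  by apply: continuous_funD; [exact: cst_continuous|exact: continuous_funZ].
have c2 : continuous (fun x => - rellich_dg D n (rho x)
    - rellich_g D n (rho x) ^+ 2 / hardy_w D n (rho x)).
  have cf (F : R -> R) : (forall s, k <= s <= M -> {for s, continuous F}) ->
      continuous (fun x => F (rho x)) by move=> cF; exact: (continuous_itv_comp cF rho_itv crho).
  have cdg := cf (fun s => - rellich_dg D n s)
    (fun s sI => continuous_at_funN (rellich_dg_cont D0 (itv_small sI))).
  have cg := cf _ (fun s sI => is_derive_continuous (is_derive_rellich_g n D0 (itv_small sI))).
  have cwV := cf (fun s => (hardy_w D n s)^-1) (fun s sI => continuousV
    (lt0r_neq0 (hardy_w_gt0 n (itv_small sI))) (hardy_w_cont D0 (itv_small sI))).
  exact: (continuous_funB cdg (continuous_funM (continuous_funM cg cg) cwV)).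
apply: Cc_int_le.
- by apply: Cc_mull => //; exact: Cc_div_rho.
- exact: Cc_mull.
- move=> x; rewrite mulrA mulrAC ler_wpM2r ?sqr_ge0//.
  exact (rellich_riccati n D0 (itv_small (rho_itv x))).
Qed.

End improved_inequalities.

(** * The improved Rellich inequalities *)

Theorem theorem3 (R : realType) (N : nat) (Omega : set 'rV[R]_N)
  (hN : (2 <= N)%N)
  (domOmega : domain Omega)
  (convOmega : convex_set (Omega : set (convex_lmodType 'rV[R]_N)))
  (bdOmega : exists M : R, forall x, Omega x ->
    (edist_boundary Omega x <= M%:E)%E) :
  let d := dist_boundary Omega in
  exists D0 : R, [/\ 0 < D0,
    (ereal_sup [set edist_boundary Omega x | x in Omega] <= D0%:E)%E &
    forall (D : R) (u : 'rV[R]_N -> R), D0 <= D -> test_function Omega u ->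
    let XX i x := \prod_(1 <= j < i.+1) iterlog j (d x / D) ^+ 2 in
    (\int[lebesgue_rV N]_(x in Omega) (laplacian u x ^+ 2)%:E >=
       (1 / 4)%:E *
         \int[lebesgue_rV N]_(x in Omega) (enorm (grad u x) ^+ 2 / d x ^+ 2)%:E
       + (1 / 4)%:E *
         \sum_(1 <= i <oo) \int[lebesgue_rV N]_(x in Omega)
            (enorm (grad u x) ^+ 2 / d x ^+ 2 * XX i x)%:E)%E
    /\
    (\int[lebesgue_rV N]_(x in Omega) (laplacian u x ^+ 2)%:E >=
       (9 / 16)%:E *
         \int[lebesgue_rV N]_(x in Omega) (u x ^+ 2 / d x ^+ 4)%:E
       + (5 / 8)%:E *
         \sum_(1 <= i <oo) \int[lebesgue_rV N]_(x in Omega)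
            (u x ^+ 2 / d x ^+ 4 * XX i x)%:E)%E].
Proof.
have [[x0 Ox0] oO _] := domOmega.
have [M0 dM0] := bdOmega.
have cO x y (t : R) : Omega x -> Omega y -> 0 <= t <= 1 ->
    Omega (t *: x + (1 - t) *: y).
  move=> Ox Oy /andP[t0 t1].
  by have := convOmega x y (Itv01 t0 t1) (mem_set Ox) (mem_set Oy); rewrite inE.
have bO : boundary Omega !=set0.
  apply/set0P/eqP => b0; have := dM0 _ Ox0.
  by rewrite /edist_boundary b0 image_set0 ereal_inf0.
have dM x : Omega x -> dist_boundary Omega x <= M0.
  move=> Ox; have [y [_ -> E _]] := nearest_boundary bO x.
  by have := dM0 _ Ox; rewrite E lee_fin.
have M00 : 0 < M0 by exact: lt_le_trans (dist_gt0 oO bO Ox0) (dM _ Ox0).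
have st0 : 0 < @small_t R by exact: expR_gt0.
have st1 : @small_t R <= 1.
  rewrite /small_t -[leRHS]expR0 ler_expR.
  by have := expR_ge1Dx (49 : R); lra.
move=> d; exists (M0 / @small_t R); split.
- exact: divr_gt0.
- apply: ge_ereal_sup => _ [x Ox <-]; apply: (le_trans (dM0 _ Ox)).
  by rewrite lee_fin ler_pdivlMr// ler_piMr// ltW.
move=> D u D0D tu XX.
have D0 : 0 < D by exact: lt_le_trans (divr_gt0 M00 st0) D0D.
have MD : M0 <= D * @small_t R by rewrite -ler_pdivrMr.
pose K := closure [set x | u x != 0].
have [_ cK KO] := tu.
have [rho [k [crho k0 rI rL rK]]] := clipped_distance oO cO bO M00 dM cK KO.
have rho_sup x (Kx : K x) := (rK x Kx).2.
have rhoE x : K x -> rho x = d x by move=> /rK[].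
have mO : measurable Omega by exact: open_measurable_rV.
have cu := test_partials_Cc1 tu [::]; have cpu i := test_partials_Cc1 tu [:: i].
have uK x : u x != 0 -> K x by exact: (@partials_support _ _ [::]).
have puK i x : partial i u x != 0 -> K x by exact: (@partials_support _ _ [:: i]).
pose V x := \sum_i partial i u x ^+ 2.
have VE x : enorm (grad u x) ^+ 2 = V x.
  rewrite /enorm sqr_sqrtr; last by apply: sumr_ge0 => i _; rewrite sqr_ge0.
  by apply: eq_bigr => i _; rewrite mxE.
have V0 x : 0 <= V x by apply: sumr_ge0 => i _; rewrite sqr_ge0.
have ccV : Cc V.
  apply: Cc_sum => i _.
  exact: (Cc_mulr (Cc1_Cc (cpu i)) (Cc1_Cc (cpu i)).1).
have VK x : V x != 0 -> K x.
  apply: contra_neqP => nK; apply: big1 => i _.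
  by have [->|/puK//] := eqVneq (partial i u x) 0; rewrite expr0n.
have ccu2 : Cc (fun x => u x ^+ 2) by exact: (Cc_mulr (Cc1_Cc cu) (Cc1_Cc cu).1).
have ccL : Cc (fun x => laplacian u x ^+ 2).
  have cl : Cc (laplacian u).
    by apply: Cc_sum => i _; exact: Cc1_Cc (test_partials_Cc1 tu [:: i; i]).
  exact: (Cc_mulr cl cl.1).
have LO x : laplacian u x ^+ 2 != 0 -> Omega x.
  apply: contra_neqP => nO; rewrite (_ : laplacian u x = 0) ?expr0n//.
  apply: big1 => i _; have [//|/(@test_partials_Omega _ _ _ _ tu [:: i; i])//] :=
    eqVneq (partial i (partial i u) x) 0.
rewrite (integral_domain mO ccL LO (fun x _ => erefl)).
have XXE i x : K x -> XX i x = logprod i (rho x / D) ^+ 2.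
  by move=> Kx; rewrite /XX /logprod (rhoE _ Kx) prodrXl.
(* On the support of a test function rho is d, so both right-hand sides can be
   written with rho. *)
have key (f : 'rV[R]_N -> R) m : Cc f -> (forall x, f x != 0 -> K x) ->
  (\int[lebesgue_rV N]_(x in Omega) (f x / d x ^+ m)%:E =
    (\int[lebesgue_rV N]_x (f x / rho x ^+ m))%R%:E)%E /\
  forall i, (\int[lebesgue_rV N]_(x in Omega) (f x / d x ^+ m * XX i x)%:E =
    (\int[lebesgue_rV N]_x (f x / rho x ^+ m * logprod i (rho x / D) ^+ 2))%R%:E)%E.
  move=> cf fK.
  have cfm := Cc_div_rho crho k0 rI m cf.
  split=> [|i]; apply: integral_domain => //.
  - by move=> x; have [->|/fK/KO//] := eqVneq (f x) 0; rewrite mul0r eqxx.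
  - move=> x _; have [->|/fK Kx] := eqVneq (f x) 0; first by rewrite !mul0r.
    by rewrite rhoE.
  - exact: (Cc_logprod2 crho k0 rI D0 MD).
  - by move=> x; have [->|/fK/KO//] := eqVneq (f x) 0; rewrite !mul0r eqxx.
  - move=> x _; have [->|/fK Kx] := eqVneq (f x) 0; first by rewrite !mul0r.
    by rewrite XXE// rhoE.
have hardyV n : (\int[lebesgue_rV N]_x (hardy_w D n (rho x) * V x) <=
    \int[lebesgue_rV N]_x (laplacian u x ^+ 2))%R.
  rewrite (int_laplacian_sqr tu).
  have ccw i : Cc (fun x => hardy_w D n (rho x) * partial i u x ^+ 2).
    apply: Cc_mull; last exact: (Cc_mulr (Cc1_Cc (cpu i)) (Cc1_Cc (cpu i)).1).
    apply: (continuous_itv_comp _ rI crho) => s /andP[ks sM].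
    by apply: hardy_w_cont => //; rewrite (lt_le_trans k0 ks) (le_trans sM MD).
  rewrite (_ : (fun x => hardy_w D n (rho x) * V x) =
      fun x => \sum_i hardy_w D n (rho x) * partial i u x ^+ 2); last first.
    by apply/funext => x; rewrite mulr_sumr.
  rewrite Cc_int_sum//; apply: ler_sum => i _.
  rewrite -Cc_int_sum; last first.
    move=> j _; have c2 := Cc1_Cc (test_partials_Cc1 tu [:: j; i]).
    exact: (Cc_mulr c2 c2.1).
  exact: (improved_hardy crho k0 rI rL rho_sup D0 MD n (cpu i) (puK i)).
have int0 (f : 'rV[R]_N -> R) : (forall x, 0 <= f x) -> (0 <= \int[lebesgue_rV N]_x f x)%R.
  by move=> f0; apply: Rintegral_ge0.
have rho0 x : 0 < rho x by have /andP[+ _] := rI x; exact: lt_le_trans.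
split.
- under [in leLHS]eq_integral do rewrite VE.
  under eq_eseriesr do (under eq_integral do rewrite VE).
  have [-> E2] := key V 2%N ccV VK.
  under eq_eseriesr do rewrite E2.
  apply: series_bound => [//|i|n].
    by apply: int0 => x; rewrite mulr_ge0 ?sqr_ge0// divr_ge0// exprn_ge0// ltW.
  rewrite -(int_logsum2 crho k0 rI D0 MD n); last exact: (Cc_div_rho crho k0 rI).
  apply: le_trans (hardyV n); rewrite le_eqVlt; apply/orP; left; apply/eqP.
  apply: eq_Rintegral => x _; rewrite /hardy_w; field; rewrite gt_eqF//.
- have [-> E2] := key (fun x => u x ^+ 2) 4%N ccu2 ltac:(by move=> x; rewrite expf_eq0 /= => /uK).
  under eq_eseriesr do rewrite E2.
  apply: series_bound => [//|i|n].
    by apply: int0 => x; rewrite mulr_ge0 ?sqr_ge0// divr_ge0 ?sqr_ge0// exprn_ge0// ltW.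
  rewrite -(int_logsum2 crho k0 rI D0 MD n); last exact: (Cc_div_rho crho k0 rI).
  apply: le_trans (hardyV n).
  exact: (improved_rellich crho k0 rI rL rho_sup D0 MD n cu uK).
Qed.
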